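(* Let $F,G:\mathbb R^n\to\mathbb R$ be even, $p$-homogeneous, locally Lipschitz functions with $G(x)\ne0$ for $x\neq0$, and let $\lambda_1\le\dots\le\lambda_n$ be the min-max eigenvalues of $(F,G)$. Then for every $c\in\mathbb R$, $$\alpha_c\le\min\{\#\{i:\lambda_i\le c\},\ \#\{i:\lambda_i\ge c\}\}.$$ For any eigenvector $x$ corresponding to the eigenvalue $\lambda_k$ whose multiplicity is $r$, $$N^-(x)\le k+r-1\qquad\text{and}\qquad N^+(x)\le n-k+r.$$
   Context: $F$ is $p$-homogeneous if $F(tx)=t^pF(x)$ for all $t>0$. Eigenpair of $(F,G)$: $(\lambda,x)$ with $x\ne0$ and $\nabla F(x)\cap\lambda\nabla G(x)\neq\varnothing$, $\nabla$ being the Clarke subdifferential. The genus of a nonempty symmetric set $A\subset\mathbb R^n\setminus\{0\}$ is the least $s\ge1$ such that there is an odd continuous map $A\to\mathbb S^{s-1}$. $\lambda_k=\inf_A\sup_{x\in A}F(x)/G(x)$ over compact symmetric $A\subset\mathbb R^n\setminus\{0\}$ with genus $\ge k$. The multiplicity of an eigenvalue is the genus of the set of its eigenvectors. $c$-level independence number: $\alpha_c$ is the largest $k$ for which there exist pairwise disjoint nonempty $U_1,\dots,U_k\subset\{1,\dots,n\}$ with $F(x)/G(x)=c$ for all nonzero $x\in\mathrm{span}(\mathbf 1_{U_1},\dots,\mathbf 1_{U_k})$ ($\mathbf 1_U$ the indicator vector; $\alpha_c=0$ if there is none). Nodal domains: $N^+(x)$ (resp. $N^-(x)$) is the largest $k$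 for which there are pairwise disjoint nonempty subsets $U_1,\dots,U_k$ of $\mathrm{supp}(x)$ such that $\frac{F(\sum_{i}t_i x|_{U_i})}{G(\sum_{i}t_i x|_{U_i})}\ge\frac{F(x)}{G(x)}$ (resp. $\le$) for all $(t_1,\dots,t_k)\in\mathbb R^k\setminus\{0\}$, where $x|_U$ equals $x$ on $U$ and $0$ elsewhere. *)

(* Defs.v *)
From HB Require Import structures.
From mathcomp Require Import all_boot all_order all_algebra.
From mathcomp Require Import all_classical all_reals all_analysis.
Set Implicit Arguments.
Unset Strict Implicit.
Unset Printing Implicit Defensive.
Import Order.TTheory GRing.Theory Num.Theory.
Import numFieldNormedType.Exports.
Local Open Scope classical_set_scope.
Local Open Scope ring_scope.

(* The largest k <= m satisfying P, and 0 if there is none. Below, m is the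
   number n of coordinates, and P k, which asks for k pairwise disjoint nonempty
   subsets of 'I_n, fails beyond n. *)
Definition largest (m : nat) (P : nat -> Prop) : nat :=
  \max_(k < m.+1 | `[< P k >]) k.

Section FunctionPairs.
Context {R : realType} {n : nat}.
Implicit Types (F G : 'rV[R]_n -> R) (x v xi : 'rV[R]_n) (A : set 'rV[R]_n).

Definition even_fun F := forall x, F (- x) = F x.

Definition homogeneous (p : R) F :=
  forall t x, 0 < t -> F (t *: x) = t `^ p * F x.

Definition locally_lipschitz F :=
  forall x, exists2 U, nbhs x U & [lipschitz F y | y in U].

Definition dotv xi v : R := \sum_j xi 0 j * v 0 j.

(* Clarke's generalized directional derivative, with yt = (y, t) *)
Definition clarke_dderiv F x v : \bar R :=
  limf_esup
    (fun yt : 'rV[R]_n * R => ((F (yt.1 + yt.2 *: v) - F yt.1) / yt.2)%:E)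
    (filter_prod (nbhs x) 0^'+).

Definition clarke_subdiff F x : set 'rV[R]_n :=
  [set xi | forall v, ((dotv xi v)%:E <= clarke_dderiv F x v)%E].

Definition eigenpair F G (lambda : R) x :=
  x != 0 /\
  clarke_subdiff F x `&` [set lambda *: eta | eta in clarke_subdiff G x] !=set0.

Definition symmetric_set A := forall x, A x -> A (- x).

Definition unit_sphere (s : nat) : set 'rV[R]_s :=
  [set y | \sum_j y 0 j ^+ 2 = 1].

Definition odd_map_to_sphere A (s : nat) :=
  exists f : 'rV[R]_n -> 'rV[R]_s,
    [/\ {within A, continuous f},
        forall x, A x -> f (- x) = - f x
      & forall x, A x -> unit_sphere (f x)].

(* Meant for nonempty symmetric A avoiding 0: then s = n is always possible, by
   normalization, and the default value 0 is not reached. *)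
Definition genus A : nat :=
  if pselect (exists s, (0 < s)%N && `[< odd_map_to_sphere A s >]) is left ex
  then ex_minn ex else 0%N.

(* These are ordinary real inf and sup: for 1 <= k <= n, homogeneity and
   continuity make F / G bounded on nonzero vectors, and the unit sphere
   belongs to the family. *)
Definition minmax_eigenvalue F G (k : nat) : R :=
  inf [set sup [set F x / G x | x in A] | A in
    [set A | [/\ compact A, symmetric_set A, A !=set0, ~ A 0
               & (k <= genus A)%N]]].

Definition multiplicity F G (lambda : R) : nat :=
  genus [set x | eigenpair F G lambda x].

Definition disjoint_nonempty k (U : 'I_k -> {set 'I_n}) :=
  (forall i, U i != finset.set0) /\
  (forall i j, i != j -> (U i :&: U j)%SET = finset.set0).

Definition restrict x (U : {set 'I_n}) : 'rV[R]_n :=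
  \row_j (if j \in U then x 0 j else 0).

Definition indicator_vec (U : {set 'I_n}) : 'rV[R]_n :=
  \row_j (if j \in U then 1 else 0).

Definition supp x : {set 'I_n} := [set j | x 0 j != 0]%SET.

Definition level_independence F G (c : R) : nat :=
  largest n (fun k => exists2 U : 'I_k -> {set 'I_n}, disjoint_nonempty U &
    forall y : 'rV[R]_n,
      y \in <<[seq indicator_vec (U i) | i : 'I_k]>>%VS -> y != 0 ->
      F y / G y = c).

Definition scaled_sum x k (U : 'I_k -> {set 'I_n}) (t : 'rV[R]_k) : 'rV[R]_n :=
  \sum_i t 0 i *: restrict x (U i).

Definition nodal_plus F G x : nat :=
  largest n (fun k => exists U : 'I_k -> {set 'I_n},
    [/\ disjoint_nonempty U, forall i, U i \subset supp x
      & forall t, t != 0 ->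
          F (scaled_sum x U t) / G (scaled_sum x U t) >= F x / G x]).

Definition nodal_minus F G x : nat :=
  largest n (fun k => exists U : 'I_k -> {set 'I_n},
    [/\ disjoint_nonempty U, forall i, U i \subset supp x
      & forall t, t != 0 ->
          F (scaled_sum x U t) / G (scaled_sum x U t) <= F x / G x]).

End FunctionPairs.

(* Main.v *)
Require Import Defs.
From HB Require Import structures.
From mathcomp Require Import all_boot all_order all_algebra.
From mathcomp Require Import all_classical all_reals all_analysis.
From mathcomp Require Import zify ring lra.
Set Implicit Arguments.
Unset Strict Implicit.
Unset Printing Implicit Defensive.
Import Order.TTheory GRing.Theory Num.Theory.
Import numFieldNormedType.Exports.
Local Open Scope classical_set_scope.
Local Open Scope ring_scope.

(** Write q = F / G. Everything except one critical point theorem comes from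
comparing the sets A of the min-max formula with linear subspaces E of
dimension m.
- If q <= c on E \ {0}, then lambda_m <= c, because the unit sphere of E has
  genus at least m: that is the Borsuk-Ulam theorem ([borsuk_ulam],
  [minmax_le_subspace]).
- If q >= c on E \ {0}, then lambda_(n-m+1) >= c. Indeed a set A missing E is
  mapped oddly and without zeros to R^(n-m) by a linear map with kernel E, so
  its genus is at most n - m ([genus_meets_subspace], [minmax_ge_subspace]).
For indicator vectors of k disjoint sets, on whose span q = c, both bounds hold,
and the monotonicity of the lambda_i gives the first claim.

For an eigenvector x of lambda_k, Euler's identity for Clarke subgradients gives
q(x) = lambda_k ([euler_subdiff], [eigenpair_rayleigh]); m pieces of x as in the
definition of N^- (resp. N^+) span a subspace of dimension m on which
q <= lambda_k (resp. q >= lambda_k). If m exceeded the claimed bound, the two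
facts above would give some j with lambda_j >= lambda_k >= lambda_(j+r), and this
contradicts the Lusternik-Schnirelmann theorem [minmax_multiplicity]: when the
eigenvectors of c have genus r, lambda_(j+r) <= c forces lambda_j < c.

The latter is proved by deformation. Let Phi = F - c G (up to the sign of G). At
a point x that is not an eigenvector of c, a Hahn-Banach separation of the two
Clarke derivatives yields a direction v along which Phi decreases, uniformly for
all base points near x ([descent_direction]). Moving by small bumps along finitely
many such directions, one after the other, is an odd continuous map theta that
never increases Phi and strictly decreases it on a given compact set free of
eigenvectors ([odd_descent_compact]). An odd map from the eigenvectors to a sphere
of R^r extends by Tietze's theorem to an odd continuous map H. Given A of genus at
least j + r on which q is barely above c, theta sends A /\ {H = 0} into {q < c}; its
image B has genus at least j, for otherwise H and an odd map on B would combine to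
an odd map from A without zeros into a space of dimension less than j + r. Hence
lambda_j <= max_B q < c.

Borsuk-Ulam is proved by Ky Fan's parity count. The sphere of R^d is taken as the
boundary of the cross-polytope, with hemispheres H_0, ..., H_(d-1) such that the
boundary of H_(i+1) is the sum modulo 2 of H_i and its antipode; barycentric
subdivision keeps these relations and makes the simplices small. An odd map
without zeros to R^m labels each vertex by a coordinate of large modulus and its
sign, so that a small simplex carries no two opposite labels. The number of
simplices of H_i whose labels, once sorted, alternate in sign has a parity
independent of i ([hemispheres_alternating]); it is odd for i = 0, so H_(d-1)
contains such a simplex, whose d vertices use d different coordinates. *)

(** * Simplicial chains modulo 2 *)
Section Chains.
Context (V : eqType).
Implicit Types (s : seq V) (c : seq (seq V)) (w : seq V -> bool).

(** The facets of the simplex with vertex list s. *)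
Fixpoint drops s : seq (seq V) :=
  if s is x :: s' then s' :: [seq x :: u | u <- drops s'] else [::].

(** A chain modulo 2 is a list of simplices. Instead of quotienting lists, chains
are compared through the parities of the numbers of members satisfying a
predicate: an identity between chains is one between parities for every w. *)
Definition parity w c : bool := \big[addb/false]_(s <- c) w s.

End Chains.

Lemma drops_map (A B : eqType) (f : A -> B) s :
  drops (map f s) = [seq map f u | u <- drops s].
Proof. by elim: s => //= x s ->; rewrite -!map_comp. Qed.

Lemma parity_map (A B : eqType) (w : seq B -> bool) (f : seq A -> seq B) c :
  parity w [seq f s | s <- c] = parity (w \o f) c.
Proof. exact: big_map. Qed.

Section Boundary.
Context (V : eqType).
Implicit Types (s : seq V) (c : seq (seq V)) (w : seq V -> bool).

Definition bdry c := flatten [seq drops s | s <- c].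

Lemma parity_cat w c1 c2 : parity w (c1 ++ c2) = parity w c1 (+) parity w c2.
Proof. exact: big_cat. Qed.

Lemma parity_cons w s c : parity w (s :: c) = w s (+) parity w c.
Proof. exact: big_cons. Qed.

Lemma parity_nil w : parity w [::] = false.
Proof. exact: big_nil. Qed.

Lemma parity_seq1 w s : parity w [:: s] = w s.
Proof. exact: big_seq1. Qed.

Lemma parity_flatten w (f : seq V -> seq (seq V)) c :
  parity w (flatten [seq f s | s <- c]) = parity (fun s => parity w (f s)) c.
Proof. by rewrite /parity big_flatten big_map. Qed.

Lemma parity_addb w1 w2 c :
  parity (fun s => w1 s (+) w2 s) c = parity w1 c (+) parity w2 c.
Proof. exact: big_split. Qed.

Lemma eq_parity w1 w2 c : {in c, w1 =1 w2} -> parity w1 c = parity w2 c.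
Proof. by move=> e; apply: eq_big_seq => s; apply: e. Qed.

Lemma parity_bdry_cons w b c :
  parity w (bdry [seq b :: s | s <- c]) =
  parity w c (+) parity (fun s => w (b :: s)) (bdry c).
Proof.
rewrite /bdry !parity_flatten -parity_addb parity_map.
by apply: eq_parity => s _ /=; rewrite parity_cons parity_map.
Qed.

Lemma parity_bdry_cat w c1 c2 :
  parity w (bdry (c1 ++ c2)) = parity w (bdry c1) (+) parity w (bdry c2).
Proof. by rewrite /bdry map_cat flatten_cat parity_cat. Qed.

Lemma parity_bdry_drops w s : parity w (bdry (drops s)) = false.
Proof.
elim: s w => [|x s IHs] w /=; first exact: parity_nil.
by rewrite -cat1s parity_bdry_cat parity_bdry_cons IHs addbF /bdry /= cats0 addbb.
Qed.

Lemma size_drops s u : u \in drops s -> size s = (size u).+1.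
Proof.
elim: s u => [//|x s IHs] u /=; rewrite inE => /orP[/eqP->//|].
by case/mapP => v /IHs -> ->.
Qed.

Lemma mem_drops s u : u \in drops s -> {subset u <= s}.
Proof.
elim: s u => [//|x s IHs] u /=; rewrite inE => /orP[/eqP-> y ys|].
  by rewrite inE ys orbT.
case/mapP => v /IHs vs -> y; rewrite !inE => /orP[->//|/vs ->].
by rewrite orbT.
Qed.

Lemma drops_subseq s u : u \in drops s -> subseq u s.
Proof.
elim: s u => [//|x s IHs] u /=; rewrite inE => /orP[/eqP->|].
  exact: subseq_cons.
by case/mapP => v /IHs vs -> /=; rewrite eqxx.
Qed.

Section Subdivision.
Context (b : seq V -> V).

(** Barycentric subdivision of a simplex with k vertices, where b chooses the new
interior vertex: the cone from b s over the subdivided facets. *)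
Fixpoint sdiv k s : seq (seq V) :=
  if k is k'.+1 then [seq b s :: u | u <- flatten [seq sdiv k' t | t <- drops s]]
  else [:: s].

Definition sdchain k c := flatten [seq sdiv k s | s <- c].

Lemma size_sdiv k s u : size s = k -> u \in sdiv k s -> size u = k.
Proof.
elim: k s u => [|k IHk] s u /= sk; first by rewrite inE => /eqP->.
case/mapP => v /flattenP[t' /mapP[t tdr ->] vt] -> /=.
by rewrite (IHk t)//; move: (size_drops tdr); rewrite sk => -[].
Qed.

(** Subdivision is a chain map: the sides of the cone cancel, since they are the
cone over the subdivision of the boundary of a boundary. *)
Lemma parity_bdry_sdiv k w s : size s = k.+1 ->
  parity w (bdry (sdiv k.+1 s)) = parity w (sdchain k (drops s)).
Proof.
elim: k w s => [|k IHk] w s sk; rewrite [sdiv _.+1 _]/= parity_bdry_cons.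
  case: s sk => [//|x []]// _ /=; rewrite /sdchain /= /bdry /=.
  by rewrite parity_nil addbF.
set w' := fun u => w (b s :: u); suff -> : parity w' (bdry
    (flatten [seq sdiv k.+1 t | t <- drops s])) = false by rewrite addbF.
rewrite {1}/bdry !parity_flatten.
transitivity (parity (fun u => parity w' (sdiv k u)) (bdry (drops s))); last first.
  exact: parity_bdry_drops.
rewrite [in RHS]/bdry parity_flatten; apply: eq_parity => t tdr.
transitivity (parity w' (bdry (sdiv k.+1 t))).
  by rewrite /bdry parity_flatten.
rewrite IHk /sdchain ?parity_flatten//.
by move: (size_drops tdr); rewrite sk => -[].
Qed.

Lemma parity_bdry_sdchain k w c : {in c, forall s, size s = k.+1} ->
  parity w (bdry (sdchain k.+1 c)) = parity w (sdchain k (bdry c)).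
Proof.
move=> ck; rewrite /sdchain /bdry !parity_flatten; apply: eq_parity => s /ck sk.
by rewrite -[LHS]parity_flatten -/(bdry _) parity_bdry_sdiv// -parity_flatten.
Qed.

End Subdivision.

Section Antipode.
Context (op : V -> V).

Lemma sdiv_map b k s : (forall u, b (map op u) = op (b u)) ->
  sdiv b k (map op s) = [seq map op u | u <- sdiv b k s].
Proof.
move=> bop; elim: k s => [//|k IHk] s /=.
have -> : [seq sdiv b k t | t <- drops (map op s)] =
    [seq [seq map op u | u <- v] | v <- [seq sdiv b k t | t <- drops s]].
  by rewrite drops_map -!map_comp; apply: eq_map => t /=; apply: IHk.
by rewrite -map_flatten bop -!map_comp.
Qed.

(** H i is an i-dimensional hemisphere and op the antipodal map. The boundary of a
vertex is the empty simplex, which makes the count below start at dimension 0. *)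
Definition hemispheres (H : nat -> seq (seq V)) :=
  [/\ forall i, {in H i, forall s, size s = i.+1},
      forall w, parity w (bdry (H 0)) = w [::]
    & forall w i, parity w (bdry (H i.+1)) =
        parity w (H i) (+) parity (w \o map op) (H i)].

(** Hemispheres of the cross-polytope with vertices e i and op (e i): the next one
is the cone from a new vertex over the whole previous sphere. *)
Fixpoint cones (e : nat -> V) i : seq (seq V) :=
  if i is i'.+1 then
    [seq e i :: s | s <- cones e i' ++ [seq map op s | s <- cones e i']]
  else [:: [:: e 0]].

Lemma conesS e i : cones e i.+1 =
  [seq e i.+1 :: s | s <- cones e i ++ [seq map op s | s <- cones e i]].
Proof. by []. Qed.

Lemma hemispheres_cones e : involutive op -> hemispheres (cones e).
Proof.
move=> opK.
have bdop w c : parity w (bdry [seq map op s | s <- c]) =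
    parity (w \o map op) (bdry c).
  rewrite /bdry !parity_flatten parity_map; apply: eq_parity => s _ /=.
  by rewrite drops_map parity_map.
split=> [i|w|].
- elim: i => [|i IHi] s /=; first by rewrite inE => /eqP->.
  case/mapP => u; rewrite mem_cat => /orP[/IHi su ->/=|]; first by rewrite su.
  by case/mapP => v /IHi sv -> -> /=; rewrite size_map sv.
- by rewrite /bdry /= parity_seq1.
move=> w i; elim: i w => [|i IHi] w;
  rewrite conesS parity_bdry_cons parity_cat parity_map;
  rewrite [X in _ (+) X](_ : _ = false) ?addbF//;
  rewrite parity_bdry_cat bdop.
  by rewrite /bdry /= !parity_seq1 addbb.
rewrite !IHi; set w' := fun u => w (e i.+2 :: u).
rewrite [X in _ (+) (_ (+) X)](_ : _ = parity w' (cones e i)).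
  by rewrite [X in _ (+) X]addbC addbb.
by apply: eq_parity => u _; rewrite /= -map_comp map_id_in// => x _ /=; exact: opK.
Qed.

Lemma hemispheres_sdchain b H : (forall u, b (map op u) = op (b u)) ->
  hemispheres H -> hemispheres (fun i => sdchain b i.+1 (H i)).
Proof.
move=> bop [Hsize H0 HS].
have E w i : parity w (bdry (sdchain b i.+1 (H i))) =
    parity (fun u => parity w (sdiv b i u)) (bdry (H i)).
  by rewrite parity_bdry_sdchain// parity_flatten.
split=> [i s /flattenP[t /mapP[u /Hsize su ->]]|w|w i].
- exact: size_sdiv.
- by rewrite E H0 parity_seq1.
rewrite E HS /sdchain !parity_flatten; congr (_ (+) _).
apply: eq_parity => u _; transitivity (parity w (sdiv b i.+1 (map op u))) => //.
by rewrite sdiv_map// parity_map.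
Qed.

Lemma sdiv_ind b (P : V -> Prop) k s u :
  (forall t, t != [::] -> {in t, forall x, P x} -> P (b t)) ->
  size s = k -> {in s, forall x, P x} -> u \in sdiv b k s -> {in u, forall x, P x}.
Proof.
move=> Pb; elim: k s u => [|k IHk] s u sk Ps; first by rewrite inE => /eqP->.
case/mapP => v /flattenP[t' /mapP[t tdr ->] vt] -> x.
rewrite inE => /orP[/eqP->|]; first by apply: Pb => //; case: s sk {Ps tdr}.
move: x; apply: (IHk t) => //; first by move: (size_drops tdr); rewrite sk => -[].
by move=> x /(mem_drops tdr) /Ps.
Qed.

End Antipode.
End Boundary.

(** * Counting simplices with alternating labels *)
Section KyFan.

Fixpoint alternates (b : bool) (L : seq bool) :=
  if L is x :: L' then (x == b) && alternates (~~ b) L' else true.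

(** The facets of an alternating list that alternate with a prescribed first sign
come only from dropping one end. In any other list, such facets cancel in pairs. *)
Lemma parity_alternates_drops b L :
  parity (alternates b) (drops L) = alternates true L (+) alternates false L.
Proof.
elim: L b => [|x L IHL] b /=; first by rewrite parity_nil.
rewrite parity_cons parity_map.
rewrite [X in _ (+) X](_ : _ =
  (x == b) && (alternates true L (+) alternates false L)); last first.
  rewrite -(IHL (~~ b)); case: (x =P b) => [->|/eqP/negbTE xb] /=.
    by apply: eq_parity => u _ /=; rewrite eqxx.
  by rewrite /parity big1// => u _ /=; rewrite xb.
by case: x b => [] [] /=; case: (alternates true L); case: (alternates false L).
Qed.

(** The label 2 i + b stands for coordinate i with sign b; this is the label with the
opposite sign. *)
Definition antilabel m := (m./2).*2 + ~~ odd m.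

Definition noncomplementary (L : seq nat) :=
  {in L &, forall x y, x./2 = y./2 -> x = y}.

Context (V : eqType) (op : V -> V) (lab : V -> nat).

(** Sorting makes the condition independent of the order of the vertices. *)
Definition alternating_labels b (s : seq V) :=
  alternates b (map odd (sort leq (map lab s))).

(** Although facets are ordered lists, summing a symmetric predicate over them gives
a symmetric predicate, because facets can be described by removing values. *)
Lemma parity_drops_perm (T : eqType) (W : seq T -> bool) s s' :
  (forall u u', perm_eq u u' -> W u = W u') -> perm_eq s s' ->
  parity W (drops s) = parity W (drops s').
Proof.
have E (w : seq T -> bool) t : (forall u u', perm_eq u u' -> w u = w u') ->
    parity w (drops t) = \big[addb/false]_(x <- t) w (rem x t).
  elim: t w => [|x t IHt] w wp; first by rewrite big_nil parity_nil.
  rewrite /= parity_cons parity_map IHt => [|u u' uu']; last first.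
    by apply: wp; rewrite perm_cons.
  rewrite big_cons /= eqxx; congr (_ (+) _); apply: eq_big_seq => y yt /=.
  by case: eqP => [->|//]; apply: wp; rewrite perm_sym perm_to_rem.
move=> Wp ss'; rewrite !E// (perm_big _ ss') /=.
apply: eq_big_seq => x xs'; apply: Wp; rewrite -(perm_cons x).
rewrite -(permPl (perm_to_rem _)) ?(perm_mem ss')//.
by rewrite (permPl ss') perm_to_rem.
Qed.

Lemma parity_alternating_drops b s :
  parity (alternating_labels b) (drops s) =
  alternating_labels true s (+) alternating_labels false s.
Proof.
pose W L := alternates b (map odd (sort leq L)).
transitivity (parity W (drops (sort leq (map lab s)))); last first.
  rewrite /alternating_labels -(parity_alternates_drops b) drops_map parity_map.
  apply: eq_parity => u /drops_subseq us; rewrite /W /=.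
  rewrite sorted_sort//; first exact: leq_trans.
  by apply: (subseq_sorted leq_trans us); apply: sort_sorted; exact: leq_total.
rewrite -(parity_drops_perm (s := map lab s)) ?drops_map ?parity_map//.
  move=> u u' uu'; rewrite /W; congr (alternates _ (map _ _)).
  by apply/perm_sortP => //; [exact: leq_total|exact: leq_trans|exact: anti_leq].
by rewrite perm_sym perm_sort.
Qed.

(** Swapping signs preserves the sorted order only because no two labels of s are
opposite. *)
Lemma alternating_op b s : noncomplementary (map lab s) ->
  {in s, forall x, lab (op x) = antilabel (lab x)} ->
  alternating_labels b (map op s) = alternating_labels (~~ b) s.
Proof.
move=> nc labop; rewrite /alternating_labels.
have -> : map lab (map op s) = map antilabel (map lab s).
  by rewrite -!map_comp; apply/eq_in_map => x /labop.
set L := map lab s in nc *.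
have -> : sort leq (map antilabel L) = map antilabel (sort leq L).
  apply: (@sorted_eq _ leq); [exact: leq_trans|exact: anti_leq| | |].
  - by apply: sort_sorted; exact: leq_total.
  - rewrite sorted_map; apply: (@sub_in_sorted _ (mem L) leq).
    + move=> x y xL yL xy /=; have := nc _ _ xL yL; rewrite /antilabel.
      case: (ltngtP x./2 y./2) => h; [lia|lia|move=> /(_ h) ->//].
    + by apply/allP => x; rewrite mem_sort.
    + by apply: sort_sorted; exact: leq_total.
  - by rewrite perm_sort perm_map// perm_sym perm_sort.
have o m : odd (antilabel m) = ~~ odd m by rewrite /antilabel; lia.
rewrite -map_comp; elim: (sort leq L) b => [//|x M IHM] b /=.
by rewrite o IHM; case: (odd x) b => [] [].
Qed.

(** In the sorted list consecutive labels have different signs, hence different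
coordinates, as opposite labels are excluded. *)
Lemma size_alternating b s m : noncomplementary (map lab s) ->
  {in s, forall x, (lab x < m.*2)%N} -> alternating_labels b s -> (size s <= m)%N.
Proof.
move=> nc labm; rewrite /alternating_labels -(size_map lab) -(size_sort leq).
set M := sort leq _ => alt.
have sM : sorted leq M by apply: sort_sorted; exact: leq_total.
have {}nc : noncomplementary M by move=> x y; rewrite !mem_sort; apply: nc.
have Mm : all (fun x => (x < m.*2)%N) M.
  by apply/allP => x; rewrite mem_sort => /mapP[y /labm ? ->].
have sh : sorted ltn (map half M).
  move: alt sM nc {Mm}; case: M => [//|x M]; rewrite /sorted /=.
  elim: M x b => [//|y M IHM] x b /= /and3P[/eqP ox /eqP oy alt] /andP[xy sM] nc.
  rewrite (IHM y (~~ b)) ?oy ?eqxx//; last first.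
    by move=> u v uM vM; apply: nc; rewrite inE ?uM ?vM orbT.
  have := nc x y; rewrite !inE !eqxx orbT => /(_ isT isT).
  by rewrite andbT; case: (ltngtP x./2 y./2) => h; [lia|lia|move=> /(_ h); lia].
have uM : uniq (map half M) by apply: (sorted_uniq ltn_trans ltnn).
rewrite -(size_map half) -(size_iota 0 m); apply: uniq_leq_size => // x.
case/mapP => y /(allP Mm) ym ->; rewrite mem_iota /=; lia.
Qed.

(** Count modulo 2 the facets of the simplices of H (i+1) that alternate starting
with +. Simplex by simplex this counts alternating simplices of H (i+1); over the
whole boundary it counts those of H i starting with +, and those of its antipode,
which correspond to those of H i starting with -. So the parity passes from H i to
H (i+1). *)
Lemma hemispheres_alternating (H : nat -> seq (seq V)) d :
  hemispheres op H ->
  (forall i, (i < d)%N -> {in H i, forall s, noncomplementary (map lab s)}) ->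
  (forall i, (i < d)%N -> {in H i, forall s,
     {in s, forall x, lab (op x) = antilabel (lab x)}}) ->
  forall i, (i < d)%N ->
    parity (alternating_labels true) (H i) (+) parity (alternating_labels false) (H i).
Proof.
move=> [Hsize H0 HS] nc labop.
have A i : (parity (alternating_labels true) (H i) (+)
    parity (alternating_labels false) (H i))
    = parity (alternating_labels true) (bdry (H i)).
  rewrite /bdry parity_flatten -parity_addb.
  by apply: eq_parity => s _; rewrite parity_alternating_drops.
elim=> [|i IHi] id; first by rewrite A H0.
rewrite A HS; have /IHi : (i < d)%N by lia.
congr (_ (+) _); apply: eq_parity => s sH /=.
rewrite alternating_op//; [apply: (nc i)|apply: (labop i)] => //; lia.
Qed.

End KyFan.

(** * Fine triangulations of the sphere *)
Section RowNorm.
Context {R : realType}.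

Lemma coord_le_norm n (x : 'rV[R]_n) j : `|x 0 j| <= `|x|.
Proof.
rewrite [leRHS](mx_normrE x); apply/bigmax_geP; right => /=.
by exists (0, j).
Qed.

Lemma norm_le_coord n (x : 'rV[R]_n) r :
  0 <= r -> (forall j, `|x 0 j| <= r) -> `|x| <= r.
Proof.
move=> r0 xr; rewrite [leLHS](mx_normrE x); apply/bigmax_leP; split=> //=.
by move=> [i j] _ /=; rewrite ord1.
Qed.

Lemma cvg_row (T : Type) (F : set_system T) {FF : Filter F} n
    (f : T -> 'rV[R]_n) (l : 'rV[R]_n) :
  (forall j, f t 0 j @[t --> F] --> l 0 j) -> f t @[t --> F] --> l.
Proof.
move=> fl; apply/cvgrPdist_le => e e0.
have : \forall t \near F, forall j, `|l 0 j - f t 0 j| <= e.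
  by apply: filter_forall => j; have /cvgrPdist_le/(_ e e0) := fl j.
apply: filterS => t fte; apply: norm_le_coord => [|j]; first exact: ltW.
by rewrite !mxE.
Qed.

Lemma continuous_sum (V : normedModType R) (T : topologicalType)
    (I : finType) (f : I -> T -> V) :
  (forall i, continuous (f i)) -> continuous (fun t => \sum_i f i t).
Proof. by move=> fc; apply: continuous_big => //; exact: add_continuous. Qed.

End RowNorm.

Section BorsukUlam.
Context {R : realType} {d : nat}.
Implicit Types (s u : seq 'rV[R]_d).

Definition barycenter s : 'rV[R]_d := (size s)%:R^-1 *: \sum_(v <- s) v.

Lemma barycenterN s : barycenter (map -%R s) = - barycenter s.
Proof. by rewrite /barycenter size_map big_map sumrN scalerN. Qed.

(** Closed balls are convex. *)
Lemma norm_barycenter_sub s y r : s != [::] ->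
  {in s, forall v, `|y - v| <= r} -> `|y - barycenter s| <= r.
Proof.
move=> s0 ysr; have sz : (0 < (size s)%:R :> R) by rewrite ltr0n; case: s s0 {ysr}.
have -> : y - barycenter s = (size s)%:R^-1 *: \sum_(v <- s) (y - v).
  rewrite big_split /= sumrN big_const_seq count_predT iter_addr addr0 scalerDr.
  by rewrite scalerN -(scaler_nat _ y) scalerA mulVf ?gt_eqF// scale1r.
rewrite normrZ ger0_norm ?invr_ge0 ?(ltW sz)// ler_pdivrMl//.
apply: (le_trans (ler_norm_sum _ _ _)); rewrite big_seq.
apply: (@le_trans _ _ (\sum_(v <- s | v \in s) r)); first exact: ler_sum.
by rewrite -big_seq big_const_seq count_predT iter_addr addr0 mulr_natl.
Qed.

(** One of the terms of the mean of v - y vanishes, whence the factor less than 1. *)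
Lemma norm_barycenter_mem s y r : y \in s -> 0 <= r ->
  {in s, forall v, `|v - y| <= r} ->
  `|barycenter s - y| <= (1 - (size s)%:R^-1) * r.
Proof.
move=> ys r0 ysr.
have sz : (0 < (size s)%:R :> R) by rewrite ltr0n; case: s ys {ysr}.
have -> : barycenter s - y = (size s)%:R^-1 *: \sum_(v <- s) (v - y).
  rewrite big_split /= sumrN big_const_seq count_predT iter_addr addr0 scalerDr.
  by rewrite -mulNrn -(scaler_nat _ (- y)) scalerA mulVf ?gt_eqF// scale1r.
rewrite normrZ ger0_norm ?invr_ge0 ?(ltW sz)// ler_pdivrMl//.
rewrite mulrA mulrBr mulr1 divff ?gt_eqF//.
apply: (le_trans (ler_norm_sum _ _ _)); rewrite (big_rem _ ys) /= subrr normr0 add0r.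
rewrite big_seq; apply: (@le_trans _ _ (\sum_(v <- rem y s | v \in rem y s) r)).
  by apply: ler_sum => v /mem_rem /ysr.
rewrite -big_seq big_const_seq count_predT iter_addr addr0 size_rem//.
rewrite -(mulr_natl r) ler_wpM2r// -subn1 natrB//.
by rewrite -(ltr0n R).
Qed.

(** New vertices lie in the convex hull of the old ones, so each of them is as close
to the barycenter as an old vertex can be. *)
Lemma mesh_sdiv k s u r : size s = k -> (k <= d)%N -> 0 <= r ->
  {in s &, forall x y, `|x - y| <= r} -> u \in sdiv barycenter k s ->
  {in u &, forall x y, `|x - y| <= (1 - d%:R^-1) * r}.
Proof.
elim: k s u => [|k IHk] s u sk kd r0 sr.
  by rewrite inE => /eqP->; move/size0nil: sk => ->.
case/mapP => v /flattenP[t' /mapP[t tdr ->] vt] ->.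
have d0 : (0 < d%:R :> R) by rewrite ltr0n; lia.
have q0 : 0 <= (1 - d%:R^-1) * r.
  by rewrite mulr_ge0// subr_ge0 invf_le1// ler1n; lia.
have vr : {in v &, forall x y, `|x - y| <= (1 - d%:R^-1) * r}.
  apply: (IHk t v) => //; first by move: (size_drops tdr); rewrite sk => -[].
    lia.
  by move=> x y /(mem_drops tdr) xs /(mem_drops tdr) ys; apply: sr.
have bv : {in v, forall x, `|barycenter s - x| <= (1 - d%:R^-1) * r}.
  apply: (sdiv_ind _ _ _ vt).
  - by move=> t'' t0 t''b; apply: norm_barycenter_sub.
  - by move: (size_drops tdr); rewrite sk => -[].
  move=> x /(mem_drops tdr) xs.
  apply: (le_trans (@norm_barycenter_mem s x r xs r0 _)).
    by move=> w ws; apply: sr.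
  rewrite ler_wpM2r// lerD2l lerN2 sk lef_pV2 ?posrE ?ltr0n ?ler_nat//; lia.
move=> x y; rewrite !inE => /orP[/eqP->|xv] /orP[/eqP->|yv].
- by rewrite subrr normr0.
- exact: bv.
- by rewrite distrC; apply: bv.
- exact: vr.
Qed.

Definition basis_vec (i : nat) : 'rV[R]_d := \row_j (j == i :> nat)%:R.

Fixpoint crosspolytope N : nat -> seq (seq 'rV[R]_d) :=
  if N is N'.+1 then fun i => sdchain barycenter i.+1 (crosspolytope N' i)
  else cones -%R basis_vec.

Lemma hemispheres_crosspolytope N : hemispheres -%R (crosspolytope N).
Proof.
elim: N => [|N IHN] /=; first by apply: hemispheres_cones; exact: opprK.
by apply: hemispheres_sdchain => // u; exact: barycenterN.
Qed.

Lemma dotvN (a x : 'rV[R]_d) : dotv (- a) (- x) = dotv a x.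
Proof. by apply: eq_bigr => j _; rewrite !mxE mulrNN. Qed.

(** Each simplex lies in a facet dotv a x = 1 of the cross-polytope, where the
entries of a are signs, or 0 for the coordinates not used yet. This hyperplane keeps the subdivided simplices away from
the origin. The vanishing of later coordinates is what allows the next vertex to
be added to the facet. *)
Lemma cones_facet i : (i < d)%N -> {in cones -%R basis_vec i, forall s,
  exists2 a : 'rV[R]_d, (forall j, `|a 0 j| <= 1) & {in s, forall x : 'rV[R]_d,
   [/\ dotv a x = 1, `|x| <= 1 & forall j : 'I_d, (i < j)%N -> x 0 j = 0]}}.
Proof.
have dotE (a : 'rV[R]_d) k : dotv a (basis_vec k) = \sum_(j < d | j == k :> nat) a 0 j.
  rewrite [RHS]big_mkcond; apply: eq_bigr => j _; rewrite mxE.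
  by case: eqP => _; rewrite ?mulr1 ?mulr0.
have nE k : `|basis_vec k| <= 1.
  by apply: norm_le_coord => // j; rewrite mxE; case: eqP; rewrite ?normr1 ?normr0.
elim: i => [|i IHi] id s.
  rewrite inE => /eqP->; exists (basis_vec 0).
    by move=> j; rewrite mxE; case: eqP; rewrite ?normr1 ?normr0.
  move=> x; rewrite inE => /eqP->; split=> //.
    rewrite dotE (big_pred1 (Ordinal id)) ?mxE//.
  by move=> j j0; rewrite mxE gtn_eqF.
rewrite conesS => /mapP[u uH ->{s}].
have [a a1 au] : exists2 a : 'rV[R]_d, (forall j, `|a 0 j| <= 1) &
  {in u, forall x : 'rV[R]_d,
   [/\ dotv a x = 1, `|x| <= 1 & forall j : 'I_d, (i < j)%N -> x 0 j = 0]}.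
  move: uH; rewrite mem_cat => /orP[|/mapP[v vH ->]]; first by apply: IHi; lia.
  have [||a a1 av] := IHi _ v; [lia|by []|].
  exists (- a) => [j|x /mapP[y /av[ay y1 y0] ->]]; first by rewrite mxE normrN.
  by split=> [||j ij]; rewrite ?dotvN ?normrN// mxE y0// oppr0.
exists (\row_j if j == i.+1 :> nat then 1 else a 0 j).
  by move=> j; rewrite mxE; case: ifP; rewrite ?normr1.
move=> x; rewrite inE => /orP[/eqP->|/au[ax x1 x0]]; split=> //.
- rewrite dotE (big_pred1 (Ordinal id)) ?mxE ?eqxx//.
- by move=> j j0; rewrite mxE gtn_eqF.
- rewrite -ax; apply: eq_bigr => j _; rewrite mxE; case: eqP => // ji.
  by rewrite x0 ?ji// !mulr0.
- by move=> j j0; apply: x0; lia.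
Qed.

(** A compact set avoiding 0 that contains the boundary of the cross-polytope. *)
Definition shell : set 'rV[R]_d :=
  [set x : 'rV[R]_d | `|x| <= 1 /\ 1 <= \sum_j `|x 0 j|].

Lemma crosspolytope_fine N i : (i < d)%N -> {in crosspolytope N i, forall s,
  {in s, forall x, shell x} /\
  {in s &, forall x y, `|x - y| <= (1 - d%:R^-1) ^+ N * 2}}.
Proof.
move=> id.
have q0 : 0 <= 1 - d%:R^-1 :> R.
  by rewrite subr_ge0 invf_le1 ?ltr0n ?ler1n; lia.
suff H : {in crosspolytope N i, forall s,
  (exists2 a : 'rV[R]_d, (forall j, `|a 0 j| <= 1) & {in s, forall x : 'rV[R]_d,
   dotv a x = 1 /\ `|x| <= 1}) /\
  {in s &, forall x y, `|x - y| <= (1 - d%:R^-1) ^+ N * 2}}.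
  move=> s /H[[a a1 aP] sd]; split=> // x /aP[ax x1]; split=> //.
  rewrite -ax; apply: ler_sum => j _; apply: (le_trans (ler_norm _)).
  by rewrite normrM ler_piMl.
elim: N => [|N IHN] s /=.
  move/(cones_facet id) => [a a1 aP]; split.
    by exists a => // x /aP[].
  move=> x y /aP[_ x1 _] /aP[_ y1 _]; rewrite expr0 mul1r.
  by apply: (le_trans (ler_normB _ _)); rewrite -[2]/(1 + 1) lerD.
case/flattenP => t' /mapP[t tH ->] st.
have [[a a1 aP] td] := IHN _ tH.
have szt : size t = i.+1 by have [Hs _ _] := hemispheres_crosspolytope N; apply: Hs tH.
split; last first.
  rewrite exprS -mulrA; apply: (mesh_sdiv szt) => //.
  by rewrite mulr_ge0// exprn_ge0.
exists a => //; apply: (sdiv_ind _ szt aP st) => v v0 vP; split.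
  have sz : (0 < (size v)%:R :> R) by rewrite ltr0n; case: v v0 {vP}.
  transitivity ((size v)%:R^-1 * \sum_(x <- v) dotv a x).
    rewrite /dotv exchange_big mulr_sumr /=; apply: eq_bigr => j _.
    rewrite /barycenter mxE summxE -mulr_sumr; ring.
  rewrite big_seq (eq_bigr (fun=> 1)) => [|x /vP[]//].
  by rewrite -big_seq big_const_seq count_predT iter_addr addr0 mulVf ?gt_eqF.
rewrite -[barycenter v]opprK normrN -sub0r; apply: norm_barycenter_sub => // x /vP[_].
by rewrite sub0r normrN.
Qed.

End BorsukUlam.

(** * The Borsuk-Ulam theorem *)
Section BorsukUlamThm.
Context {R : realType}.

Lemma compact_shell d : compact (@shell R d).
Proof.
apply: bounded_closed_compact.
  by exists 1; split=> // M M1 x [x1 _]; apply: (le_trans x1); exact: ltW.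
rewrite (_ : shell = [set x | `|x| <= 1] `&`
  (fun x : 'rV[R]_d => \sum_j `|x 0 j|) @^-1` [set t | 1 <= t]).
  apply: closedI.
    by apply: (@closed_comp _ _ (fun x : 'rV[R]_d => `|x|) [set t | t <= 1]);
      [move=> x _; apply: norm_continuous | exact: closed_le].
  apply: closed_comp; last exact: closed_ge.
  have : continuous (fun x : 'rV[R]_d => \sum_j `|x 0 j|) => [|c x _]; last exact: c.
  by apply: continuous_sum => j x; apply: continuous_comp;
    [apply: coord_continuous|apply: norm_continuous].
by apply/seteqP; split=> x.
Qed.

Lemma shell_neq0 d (x : 'rV[R]_d) : shell x -> x != 0.
Proof.
move=> [_]; apply: contraTneq => ->; rewrite big1 ?ler10// => j _.
by rewrite mxE normr0.
Qed.

Lemma compact_uniform_continuity (V W : normedModType R) (K : set V) (f : V ->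
  W) (e : R) :
  compact K -> {within K, continuous f} -> 0 < e ->
  exists2 h, 0 < h & forall x y, K x -> K y -> `|x - y| < h -> `|f x - f y| < e.
Proof.
move=> /compact_near_coveringP cK /subspace_continuousP fK e0.
pose P (h : R) x := K x -> forall y, K y -> `|x - y| < h -> `|f x - f y| < e.
have [] := cK _ (0^'+ : set_system R) P _.
  move=> x Kx; have e20 : 0 < e / 2 by rewrite divr_gt0.
  have := fK x Kx => /cvgrPdist_lt/(_ _ e20).
  rewrite /prop_near1 /within /= => /nbhs_ballP[r /= r0 xr].
  exists (ball x (r / 2), [set h | h < r / 2]) => /=.
    split; first by apply: nbhsx_ballx; rewrite divr_gt0.
    by apply: nbhs_right_lt; rewrite divr_gt0.
  move=> [z h] /= [xz hr] Kz y Ky zy.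
  have xz' : `|x - z| < r / 2 by move: xz; rewrite -ball_normE.
  have zB : `|f x - f z| < e / 2.
    apply: xr => //; rewrite -ball_normE /ball_ /=; apply: (lt_trans xz').
    by rewrite ltr_pdivrMr//; lra.
  have yB : `|f x - f y| < e / 2.
    apply: xr => //; rewrite -ball_normE /ball_ /=.
    apply: (le_lt_trans (ler_distD z x y)); rewrite [ltRHS]splitr.
    by rewrite ltrD// (lt_trans zy hr).
  apply: (le_lt_trans (ler_distD (f x) (f z) (f y))).
  by rewrite [ltRHS]splitr ltrD// distrC.
move=> h /= h0 hP; exists (h / 2); first by rewrite divr_gt0.
move=> x y Kx Ky xy; apply: (hP (h / 2)) => //=; last by rewrite divr_gt0.
by rewrite /ball_ /= sub0r normrN gtr0_norm ?divr_gt0//; lra.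
Qed.

Theorem borsuk_ulam d m (g : 'rV[R]_d -> 'rV[R]_m) :
  {within [set x | x != 0], continuous g} ->
  (forall x, x != 0 -> g (- x) = - g x) ->
  (forall x, x != 0 -> g x != 0) -> (d <= m)%N.
Proof.
move=> gc godd gn0; case: (posnP d) => [->//|d0].
have cQ := @compact_shell d.
have gQ : {within shell, continuous g}.
  apply: continuous_subspaceW gc; exact: shell_neq0.
have [s0 s0H] : exists s, s \in @crosspolytope R d 0 0.
  by exists [:: @basis_vec R d 0]; rewrite inE.
have Q0 : @shell R d !=set0.
  exists (basis_vec 0).
  by have [+ _] := crosspolytope_fine d0 s0H; move: s0H; rewrite inE => /eqP->;
     apply; rewrite inE.
have [z zQ zmin] : exists2 z, z \in @shell R d &
    forall x, x \in shell -> `|g z| <= `|g x|.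
  apply: (compact_EVT_min Q0 cQ) => x.
  by apply: continuous_comp; [exact: gQ|exact: norm_continuous].
set e := `|g z| in zmin; have e0 : 0 < e.
  by rewrite normr_gt0; apply/gn0/shell_neq0; rewrite inE in zQ.
have [h h0 gh] := compact_uniform_continuity cQ gQ e0.
(* On the shell some coordinate of g x is at least e in modulus; the first such
   coordinate is the same for x and - x. *)
pose big (x : 'rV[R]_d) := [pred j : 'I_m | e <= `|g x 0 j|].
pose lab x := if [pick j | big x j] is Some j then (j.*2 + (0 < g x 0 j)%R)%N else 0%N.
have labP x : shell x -> exists2 j : 'I_m, [pick j | big x j] = Some j &
    e <= `|g x 0 j| /\ lab x = (j.*2 + (0 < g x 0 j)%R)%N.
  move=> xQ; rewrite /lab; case: pickP => [j /= ej|nb]; first by exists j.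
  have : e <= `|g x| by apply: zmin; rewrite inE.
  suff : `|g x| < e by rewrite ltNge => /negP.
  rewrite [ltLHS](mx_normrE (g x)); apply/bigmax_ltP; split=> //= -[i j] _ /=;
    rewrite ord1 ltNge.
  by have := nb j; rewrite /= => ->.
have labN x : shell x -> lab (- x) = antilabel (lab x).
  move=> xQ; have [j pj [ej ->]] := labP x xQ.
  have x0 := shell_neq0 xQ; rewrite /lab.
  have -> : [pick j | big (- x) j] = Some j.
    by rewrite -pj; apply: eq_pick => i /=; rewrite godd// mxE normrN.
  have gj0 : g x 0 j != 0 by rewrite -normr_gt0 (lt_le_trans e0).
  rewrite godd// mxE oppr_gt0 /antilabel.
  by case: (ltgtP (g x 0 j) 0) gj0 => //= _ _; rewrite ?addn0; lia.
have lab_eq x y : shell x -> shell y -> `|x - y| < h ->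
    (lab x)./2 = (lab y)./2 -> lab x = lab y.
  move=> xQ yQ xy; have [i _ [ei ->]] := labP x xQ.
  have [j _ [ej ->]] := labP y yQ => ij.
  have {}ij : i = j.
    apply: ord_inj; move: ij; case: (0 < g x 0 i); case: (0 < g y 0 j) => /=; lia.
  rewrite {}ij in ei *.
  have : `|g x 0 j - g y 0 j| < e.
    by apply: le_lt_trans (gh x y xQ yQ xy); have := coord_le_norm (g x - g y) j;
       rewrite !mxE.
  rewrite ltr_norml => /andP[xy1 xy2]; move: ei ej; rewrite !ler_normr.
  case: (ltP 0 (g x 0 j)) => gx; case: (ltP 0 (g y 0 j)) => gy //;
    move=> /orP[ei|ei] /orP[ej|ej]; exfalso; lra.
have [N Nh] : exists N, (1 - d%:R^-1) ^+ N * 2 < h :> R.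
  have q1 : `|1 - d%:R^-1 : R| < 1.
    have dV : 0 < d%:R^-1 :> R by rewrite invr_gt0 ltr0n.
    have dV1 : d%:R^-1 <= 1 :> R by rewrite invf_le1 ?ltr0n ?ler1n.
    by rewrite ger0_norm; lra.
  have /cvgrPdist_lt/(_ h h0)[N _ /(_ N (leqnn N))] := cvg_geometric 2 q1.
  rewrite sub0r normrN => /(le_lt_trans (ler_norm _)) Nh.
  by exists N; rewrite mulrC.
have sub i (id : (i < d)%N) s : s \in @crosspolytope R d N i ->
    {in s, forall x, shell x} /\ noncomplementary (map lab s).
  move=> sH; have [sQ sd] := crosspolytope_fine id sH; split=> //.
  move=> _ _ /mapP[x xs ->] /mapP[y ys ->]; apply: lab_eq; try exact: sQ.
  by apply: le_lt_trans Nh; apply: sd.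
have dd : (d.-1 < d)%N by lia.
have nc i : (i < d)%N -> {in @crosspolytope R d N i, forall s,
    noncomplementary (map lab s)}.
  by move=> id s sH; have [] := sub i id s sH.
have lo i : (i < d)%N -> {in @crosspolytope R d N i, forall s,
    {in s, forall x, lab (- x) = antilabel (lab x)}}.
  by move=> id s sH x xs; have [sQ _] := sub i id s sH; apply: labN; apply: sQ.
have := hemispheres_alternating (hemispheres_crosspolytope N) nc lo dd.
rewrite /parity => alt.
have [s [sH [b sb]]] : exists s, s \in @crosspolytope R d N d.-1 /\
    exists b, alternating_labels lab b s.
  apply: contrapT => no; move: alt; rewrite !big1_seq// => s /= sH.
    by apply/negbTE/negP => sb; apply: no; exists s; split=> //; exists false.
  by apply/negbTE/negP => sb; apply: no; exists s; split=> //; exists true.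
have [sQ snc] := sub _ dd s sH.
have <- : size s = d.
  by have [Hs _ _] := hemispheres_crosspolytope (R := R) (d := d) N;
    rewrite (Hs _ _ sH); lia.
apply: (size_alternating snc _ sb) => x xs.
by have [j _ [_ ->]] := labP x (sQ x xs); have := ltn_ord j; case: (0 < _); lia.
Qed.

End BorsukUlamThm.

(** * Genus *)
Section Genus.
Context {R : realType}.

Lemma continuous_comp_within (T U V : topologicalType) (A : set T) (B : set U)
    (f : T -> U) (g : U -> V) :
  {within A, continuous f} -> {within B, continuous g} ->
  (forall x, A x -> B (f x)) -> {within A, continuous (g \o f)}.
Proof.
move=> /subspace_continuousP fA /subspace_continuousP gB AB.
apply/subspace_continuousP => x Ax.
apply: (cvg_comp _ _ _ (gB _ (AB _ Ax))) => P BP.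
have := fA x Ax _ BP; rewrite /within /= !nbhs_simpl /=.
by apply: filterS => y yP Ay; apply: (yP Ay); apply: AB.
Qed.

Lemma continuous_mulmxr k n (M : 'M[R]_(k, n)) :
  continuous (fun t : 'rV[R]_k => t *m M).
Proof.
move=> t; apply: (@cvg_row _ _ (nbhs t)) => j; rewrite mxE; under eq_cvg do rewrite mxE.
suff /(_ t) : continuous (fun t : 'rV[R]_k => \sum_i t 0 i * M i j) by [].
apply: (@continuous_sum _ R) => i {}t.
by apply: (@cvgM _ _ (nbhs t)); [exact: coord_continuous|exact: cvg_cst].
Qed.

(** Maps without zeros are as good as maps to the sphere, and are easier to combine. *)
Definition odd_nonvanishing n (A : set 'rV[R]_n) s :=
  exists f : 'rV[R]_n -> 'rV[R]_s, [/\ {within A, continuous f},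
    forall x, A x -> f (- x) = - f x & forall x, A x -> f x != 0].

Lemma odd_nonvanishingP n (A : set 'rV[R]_n) s :
  odd_nonvanishing A s <-> odd_map_to_sphere A s.
Proof.
split=> -[f [fc fo fA]]; last first.
  exists f; split=> // x /fA fx; apply/eqP => f0; move: fx; rewrite f0 /unit_sphere /=.
  by rewrite big1 => [/eqP|j _]; rewrite ?mxE ?expr0n// eq_sym oner_eq0.
pose N (x : 'rV[R]_s) := \sum_j x 0 j ^+ 2.
have N_gt0 x : x != 0 -> 0 < N x.
  move=> /rV0Pn[j xj]; rewrite /N (bigD1 j) //= ltr_pwDl ?exprn_even_gt0//.
  by apply: sumr_ge0 => i _; exact: sqr_ge0.
have Nc : continuous N.
  apply: continuous_sum => j x.
  apply: (@cvg_comp _ _ _ (fun y : 'rV[R]_s => y 0 j) (fun t => t ^+ 2)).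
    exact: coord_continuous.
  exact: exprn_continuous.
exists (fun x => (Num.sqrt (N (f x)))^-1 *: f x); split.
- have uc : {within [set y | y != 0],
      continuous (fun y : 'rV[R]_s => (Num.sqrt (N y))^-1 *: y)}.
    apply/subspace_continuousP => y /= y0; apply: cvg_within_filter.
    apply: cvgZ; last exact: cvg_id.
    apply: cvgV; first by rewrite gt_eqF// sqrtr_gt0 N_gt0.
    by apply: (continuous_comp (Nc y)); apply: sqrt_continuous.
  exact: (continuous_comp_within fc uc).
- move=> x Ax; rewrite fo// scalerN; congr (- (_ ^-1 *: _)).
  by congr Num.sqrt; apply: eq_bigr => j _; rewrite mxE sqrrN.
move=> x /fA /N_gt0 Nx; rewrite /unit_sphere /=.
transitivity ((Num.sqrt (N (f x)))^-1 ^+ 2 * N (f x)).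
  by rewrite mulr_sumr; apply: eq_bigr => j _; rewrite mxE exprMn.
by rewrite exprVn sqr_sqrtr ?ltW// mulVf ?gt_eqF.
Qed.

Lemma odd_nonvanishing_gt0 n (A : set 'rV[R]_n) s :
  A !=set0 -> odd_nonvanishing A s -> (0 < s)%N.
Proof.
move=> [x Ax] [f [_ _ /(_ x Ax)]]; rewrite lt0n; apply: contraNneq => s0.
by move: (f x); rewrite s0 => y; rewrite [y]thinmx0.
Qed.

Lemma genus_le n (A : set 'rV[R]_n) s :
  A !=set0 -> odd_nonvanishing A s -> (genus A <= s)%N.
Proof.
move=> A0 As; rewrite /genus; case: pselect => // ex.
case: ex_minnP => m _; apply; rewrite (odd_nonvanishing_gt0 A0 As) /=.
by apply/asboolP/odd_nonvanishingP.
Qed.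

Lemma genus_attained n (A : set 'rV[R]_n) :
  A !=set0 -> ~ A 0 -> odd_nonvanishing A (genus A).
Proof.
move=> A0 nA0.
have An : odd_nonvanishing A n.
  exists id; split=> // [|x Ax]; last by apply/eqP => x0; apply: nA0; rewrite -x0.
  by apply: continuous_subspaceT => x; exact: cvg_id.
rewrite /genus; case: pselect => [ex|[]]; last first.
  exists n; rewrite (odd_nonvanishing_gt0 A0 An) /=.
  by apply/asboolP/odd_nonvanishingP.
by case: ex_minnP => m /andP[_ /asboolP/odd_nonvanishingP].
Qed.

Definition normalize n (x : 'rV[R]_n) : 'rV[R]_n := `|x|^-1 *: x.

Lemma norm_normalize n (x : 'rV[R]_n) : x != 0 -> `|normalize x| = 1.
Proof.
by move=> x0; rewrite normrZ normfV normr_id mulVf// normr_eq0.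
Qed.

Lemma normalizeN n (x : 'rV[R]_n) : normalize (- x) = - normalize x.
Proof. by rewrite /normalize normrN scalerN. Qed.

Lemma continuous_normalize n :
  {within [set x | x != 0], continuous (@normalize n)}.
Proof.
apply/subspace_continuousP => x /= x0; apply: cvg_within_filter.
apply: cvgZ; last exact: cvg_id.
by apply: cvgV; [rewrite normr_eq0 | exact: norm_continuous].
Qed.

Lemma compact_norm1 n : compact [set x : 'rV[R]_n | `|x| = 1].
Proof.
apply: bounded_closed_compact.
  exists 1; split=> // M M1 x /= ->; exact: ltW.
apply: (@closed_comp _ _ (fun x : 'rV[R]_n => `|x|) [set 1]).
  by move=> x _; apply: norm_continuous.
exact: closed_eq.
Qed.

Definition linear_sphere k n (T : 'M[R]_(k, n)) : set 'rV[R]_n :=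
  [set t *m T | t in [set t : 'rV[R]_k | `|t| = 1]].

Lemma linear_sphere_family k n (T : 'M[R]_(k, n)) : (0 < k)%N -> row_free T ->
  [/\ compact (linear_sphere T), symmetric_set (linear_sphere T),
      linear_sphere T !=set0 & ~ linear_sphere T 0].
Proof.
move=> k0 Tfree; split.
- apply: continuous_compact (@compact_norm1 k).
  by apply: continuous_subspaceT; exact: continuous_mulmxr.
- by move=> _ [t t1 <-]; exists (- t); rewrite /= ?normrN// mulNmx.
- have e0 : const_mx 1 != 0 :> 'rV[R]_k.
    by apply/rV0Pn; exists (Ordinal k0); rewrite mxE oner_neq0.
  by exists (normalize (const_mx 1) *m T); exists (normalize (const_mx 1)) => //;
     exact: norm_normalize.
- move=> [t t1 /eqP]; rewrite -[0](mul0mx _ T) (inj_eq (row_free_inj Tfree)).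
  by move=> /eqP t0; move: t1; rewrite t0 /= normr0 => /esym/eqP; rewrite oner_eq0.
Qed.

(** This is where the Borsuk-Ulam theorem enters. *)
Lemma genus_linear_sphere k n (T : 'M[R]_(k, n)) : (0 < k)%N -> row_free T ->
  (k <= genus (linear_sphere T))%N.
Proof.
move=> k0 Tfree; have [_ Ts T0 nT0] := linear_sphere_family k0 Tfree.
have [f [fc fo f0]] := genus_attained T0 nT0.
have nT t : t != 0 -> linear_sphere T (normalize t *m T).
  by move=> t0; exists (normalize t) => //; exact: norm_normalize.
apply: (borsuk_ulam (g := fun t => f (normalize t *m T))).
- apply: (continuous_comp_within _ fc nT).
  apply: (@continuous_comp_within _ _ _ _ setT (@normalize k) (fun t => t *m T)) => //.
    exact: continuous_normalize.
  by apply: continuous_subspaceT; exact: continuous_mulmxr.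
- by move=> t t0; rewrite normalizeN mulNmx fo//; exact: nT.
- by move=> t t0; apply/f0/nT.
Qed.

(** The columns of [col_base (cokermx T)] are n - m independent linear forms whose
common kernel is the row space of T; if A missed that space, they would map A oddly
to R^(n-m) without zeros. *)
Lemma genus_meets_subspace m n (T : 'M[R]_(m, n)) (A : set 'rV[R]_n) :
  row_free T -> A !=set0 -> (n - m < genus A)%N ->
  exists t : 'rV[R]_m, A (t *m T).
Proof.
move=> Tfree A0; rewrite ltnNge => /negP gA; apply: contrapT => noA; apply: gA.
have -> : (n - m = \rank (cokermx T))%N by rewrite mxrank_coker (eqP Tfree).
apply: genus_le => //; exists (fun x => x *m col_base (cokermx T)); split.
- by apply: continuous_subspaceT; exact: continuous_mulmxr.
- by move=> x _; rewrite mulNmx.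
move=> x Ax; apply/eqP => xT; apply: noA.
have : (x <= T)%MS.
  by rewrite submxE -(mulmx_base (cokermx T)) mulmxA xT mul0mx.
by move=> /submxP[t xt]; exists t; rewrite -xt.
Qed.

End Genus.

(** * Min-max values and linear subspaces *)
Section MinMax.
Context {R : realType} {n : nat} {F G : 'rV[R]_n -> R}.
Local Notation q := (fun x => F x / G x).
Local Notation lam := (minmax_eigenvalue F G).
Implicit Types (A : set 'rV[R]_n) (c : R) (k : nat).

Definition admissible k : set (set 'rV[R]_n) :=
  [set A | [/\ compact A, symmetric_set A, A !=set0, ~ A 0 & (k <= genus A)%N]].

(** The only properties of the pair that the min-max values depend on. *)
Definition rayleigh_regular :=
  {within [set x | x != 0], continuous q} /\
  (forall t x, 0 < t -> q (t *: x) = q x).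

Context (qP : rayleigh_regular).

Lemma nonzero_of_admissible k A x : admissible k A -> A x -> x != 0.
Proof. by move=> [_ _ _ nA0 _] Ax; apply/eqP => x0; apply: nA0; rewrite -x0. Qed.

Lemma rayleigh_normalize x : x != 0 -> q (normalize x) = q x.
Proof. by move=> x0; apply: qP.2; rewrite invr_gt0 normr_gt0. Qed.

(** Together with [admissible_nonempty] this makes the infimum in the definition of
the min-max values a genuine one. *)
Lemma rayleigh_lbound : exists m, forall x, x != 0 -> m <= q x.
Proof.
have [K0|/set0P K0] := eqVneq [set x : 'rV[R]_n | `|x| = 1] set0.
  exists 0 => x x0; suff : [set x : 'rV[R]_n | `|x| = 1] (normalize x) by rewrite K0.
  exact: norm_normalize.
have qS : {within [set x : 'rV[R]_n | `|x| = 1], continuous q}.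
  apply: continuous_subspaceW qP.1 => x /= x1.
  by rewrite -normr_gt0 x1.
have [z _ zmin] := compact_EVT_min K0 (@compact_norm1 R n) qS.
exists (q z) => x x0; rewrite -(rayleigh_normalize x0); apply: zmin.
by rewrite inE; exact: norm_normalize.
Qed.

Lemma admissible_sup k A : admissible k A ->
  exists x, [/\ A x, sup [set q x | x in A] = q x & forall y, A y -> q y <= q x].
Proof.
move=> Ak; have [cA _ A0 _ _] := Ak.
have qA : {within A, continuous q}.
  by apply: continuous_subspaceW qP.1 => x; apply: nonzero_of_admissible Ak.
have [x xA xmax] := compact_EVT_max A0 cA qA.
rewrite inE in xA; have {}xmax y : A y -> q y <= q x by move=> Ay; apply: xmax;
  rewrite inE.
exists x; split=> //; apply/eqP; rewrite eq_le; apply/andP; split.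
  by apply: ge_sup; [exists (q x), x|move=> _ [y Ay <-]; exact: xmax].
by apply: ub_le_sup; [exists (q x) => _ [y Ay <-]; exact: xmax|exists x].
Qed.

Lemma minmax_le k c A : admissible k A -> (forall x, A x -> q x <= c) -> lam k <= c.
Proof.
move=> Ak Ac; have [x [Ax supA _]] := admissible_sup Ak.
apply: (@le_trans _ _ (sup [set q x | x in A])); last by rewrite supA Ac.
apply: ge_inf; last by exists A.
have [m mq] := rayleigh_lbound; exists m => _ [B Bk <-].
by have [y [By -> _]] := admissible_sup Bk; apply/mq/(nonzero_of_admissible Bk).
Qed.

(** The unit sphere of the whole space has genus at least n. *)
Lemma admissible_nonempty k : (0 < n)%N -> (k <= n)%N -> admissible k !=set0.
Proof.
move=> n0 kn; have f1 : row_free (1%:M : 'M[R]_n) by rewrite row_free_unit unitmx1.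
have [c s e z] := linear_sphere_family n0 f1.
by exists (linear_sphere 1%:M); split=> //;
  apply: leq_trans kn (genus_linear_sphere n0 f1).
Qed.

Lemma minmax_ge k c : (0 < n)%N -> (k <= n)%N ->
  (forall A, admissible k A -> exists2 x, A x & c <= q x) -> c <= lam k.
Proof.
move=> n0 kn Ac; apply: lb_le_inf.
  by have [A Ak] := admissible_nonempty n0 kn; exists (sup [set q x | x in A]), A.
move=> _ [A Ak <-]; have [y [Ay -> ymax]] := admissible_sup Ak.
by have [x Ax cx] := Ac A Ak; apply: le_trans cx (ymax _ Ax).
Qed.

Lemma minmax_lt k c : (0 < n)%N -> (k <= n)%N -> lam k < c ->
  exists2 A, admissible k A & forall x, A x -> q x < c.
Proof.
move=> n0 kn /inf_lt[].
  by have [A Ak] := admissible_nonempty n0 kn; exists (sup [set q x | x in A]), A.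
move=> _ [A Ak <-] Ac; exists A => // x Ax.
by have [y [_ supA ymax]] := admissible_sup Ak; apply: le_lt_trans (ymax _ Ax) _;
  rewrite -supA.
Qed.

Lemma minmax_mono i j : (0 < n)%N -> (i <= j)%N -> (j <= n)%N -> lam i <= lam j.
Proof.
move=> n0 ij jn; apply: minmax_ge => // A Aj.
have [x [Ax _ xmax]] := admissible_sup Aj; exists x => //.
by apply: (@minmax_le i _ A) => //; have [? ? ? ? jA] := Aj; split=> //;
  apply: leq_trans jA.
Qed.

Lemma minmax_le_subspace k (T : 'M[R]_(k, n)) c : (0 < k)%N -> row_free T ->
  (forall t, t != 0 -> q (t *m T) <= c) -> lam k <= c.
Proof.
move=> k0 Tfree qT; apply: (@minmax_le k c (linear_sphere T)).
  have [? ? ? ?] := linear_sphere_family k0 Tfree.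
  by split=> //; exact: genus_linear_sphere.
by move=> _ [t t1 <-]; apply: qT; rewrite -normr_gt0 t1.
Qed.

Lemma minmax_ge_subspace k (T : 'M[R]_(k, n)) c : (0 < k <= n)%N -> row_free T ->
  (forall t, t != 0 -> c <= q (t *m T)) -> c <= lam (n - k).+1.
Proof.
move=> /andP[k0 kn] Tfree qT; apply: minmax_ge => [||A Ak]; [lia|lia|].
have [_ _ A0 nA0 kA] := Ak.
have [t At] := genus_meets_subspace Tfree A0 kA.
exists (t *m T) => //; apply: qT; apply: contra_notN nA0 => /eqP t0.
by rewrite t0 mul0mx in At.
Qed.

End MinMax.

(** * Separation by linear forms in finite dimension *)
Section HahnBanach.
Context {R : realType} {n : nat}.
Implicit Types (u v w xi : 'rV[R]_n) (a b c : R).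

Lemma dotvDl xi eta v : dotv (xi + eta) v = dotv xi v + dotv eta v.
Proof. by rewrite /dotv -big_split; apply: eq_bigr => j _; rewrite mxE mulrDl. Qed.

Lemma dotvDr xi u v : dotv xi (u + v) = dotv xi u + dotv xi v.
Proof. by rewrite /dotv -big_split; apply: eq_bigr => j _; rewrite mxE mulrDr. Qed.

Lemma dotvZl a xi v : dotv (a *: xi) v = a * dotv xi v.
Proof. by rewrite /dotv mulr_sumr; apply: eq_bigr => j _; rewrite mxE mulrA. Qed.

Lemma dotvZr a xi v : dotv xi (a *: v) = a * dotv xi v.
Proof. by rewrite /dotv mulr_sumr; apply: eq_bigr => j _; rewrite mxE mulrCA. Qed.

Lemma dotvNr xi v : dotv xi (- v) = - dotv xi v.
Proof. by rewrite -scaleN1r dotvZr mulN1r. Qed.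

Lemma dotv_basis (v : 'rV[R]_n) (k : 'I_n) : dotv (basis_vec k) v = v 0 k.
Proof.
rewrite /dotv (bigD1 k) //= mxE eqxx mul1r big1 ?addr0// => j jk.
by rewrite mxE (negbTE (_ : j != k :> nat)) ?mul0r.
Qed.

(** Hahn-Banach, one basis vector e at a time: if xi <= h on a subspace V, then
xi + alpha e works on V + R e as soon as alpha lies between all
xi (w - e) - h (w - e) and all h (u + e) - xi (u + e) with u, w in V;
subadditivity says that the former are at most the latter. *)
Lemma sublinear_minorant (h : 'rV[R]_n -> R) :
  (forall u v, h (u + v) <= h u + h v) ->
  (forall a v, 0 < a -> h (a *: v) <= a * h v) -> 0 <= h 0 ->
  exists xi, forall v, dotv xi v <= h v.
Proof.
move=> hD hZ h0.
suff H k : exists xi, forall v, (forall j : 'I_n, (k <= j)%N -> v 0 j = 0) ->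
    dotv xi v <= h v.
  by have [xi xih] := H n; exists xi => v; apply: xih => j; rewrite leqNgt ltn_ord.
elim: k => [|k [xi xih]].
  exists 0 => v v0; have -> : v = 0 by apply/rowP => j; rewrite v0// mxE.
  by rewrite (_ : dotv _ _ = 0)// /dotv big1// => j _; rewrite mxE mul0r.
have [nk|kn] := leqP n k.
  exists xi => v v0; apply: xih => j; rewrite leqNgt (leq_trans (ltn_ord j))//.
pose K := Ordinal kn; pose e := basis_vec K : 'rV[R]_n.
pose V v := forall j : 'I_n, (k <= j)%N -> v 0 j = 0.
pose E := [set h (u + e) - dotv xi (u + e) | u in [set u | V u]].
have Elb w : V w -> lbound E (dotv xi (w - e) - h (w - e)).
  move=> wV _ [u uV <-].
  have uw : dotv xi (u + w) <= h (u + w) by apply: xih => j kj;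
    rewrite mxE uV ?wV ?addr0.
  have := hD (u + e) (w - e); rewrite addrACA subrr addr0 => uw'.
  move: uw uw'; rewrite !dotvDr dotvNr; lra.
have V0 : V 0 by move=> j _; rewrite mxE.
have E0 : E !=set0 by exists (h (0 + e) - dotv xi (0 + e)), 0.
have El : has_lbound E by exists (dotv xi (0 - e) - h (0 - e)); exact: Elb.
exists (xi + inf E *: e) => v v0; rewrite dotvDl dotvZl dotv_basis.
have Vs s : v 0 K - s * 1 = 0 -> V (v - s *: e).
  move=> vs j kj; rewrite !mxE; case: eqP => [jK|jK]; last first.
    by rewrite mulr0 subr0 v0//; move: jK => /=; lia.
  by rewrite (_ : j = K)//; apply: ord_inj.
have VZ s w : V w -> V (s *: w) by move=> wV j kj; rewrite mxE wV ?mulr0.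
case: (ltgtP (v 0 K) 0) => s0.
- pose r := - v 0 K; have r0 : 0 < r by rewrite oppr_gt0.
  pose w := r^-1 *: (v + r *: e).
  have ve : w - e = r^-1 *: v.
    by rewrite /w scalerDr scalerA mulVf ?gt_eqF// scale1r addrK.
  have wV : V w by apply: VZ; rewrite -[r]opprK scaleNr; apply: Vs; rewrite /r; lra.
  have := lb_le_inf E0 (Elb _ wV); rewrite ve dotvZr -(ler_pM2l r0) mulrBr mulrA.
  rewrite mulfV ?gt_eqF// mul1r.
  have rV0 : 0 < r^-1 by rewrite invr_gt0.
  have : r * h (r^-1 *: v) <= h v by rewrite -ler_pdivlMl//; exact: hZ.
  rewrite /r; lra.
- pose s := v 0 K; pose u := s^-1 *: (v - s *: e).
  have ve : u + e = s^-1 *: v.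
    by rewrite /u scalerBr scalerA mulVf ?gt_eqF// scale1r subrK.
  have uV : V u by apply: VZ; apply: Vs; rewrite /s; lra.
  have : inf E <= h (u + e) - dotv xi (u + e) by apply: ge_inf => //; exists u.
  have sV0 : 0 < s^-1 by rewrite invr_gt0.
  have hv : s * h (s^-1 *: v) <= h v by rewrite -ler_pdivlMl//; exact: hZ.
  rewrite ve dotvZr -(ler_pM2l s0) mulrBr mulrA mulfV ?gt_eqF// mul1r.
  rewrite -/s in hv *; lra.
- rewrite s0 mulr0 addr0; apply: xih => j; rewrite leq_eqVlt => /orP[/eqP kj|/v0//].
  by rewrite -s0; congr (v 0 _); apply: ord_inj.
Qed.

(** P v a reads: a is an upper bound of the value at v of a sublinear function.
Working with upper bounds avoids extended real values. *)
Definition sublinear_bounds (P : 'rV[R]_n -> R -> Prop) :=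
  [/\ forall u v a b, P u a -> P v b -> P (u + v) (a + b),
      forall t v a, 0 < t -> P v a -> P (t *: v) (t * a),
      P 0 0 & forall v, exists a, P v a].

(** Apply Hahn-Banach to the infimal convolution v |-> inf_w (p (v + w) + q w) of the
two sublinear functions p and q, which lies below p v and below q (- v). *)
Lemma sandwich (P Q : 'rV[R]_n -> R -> Prop) :
  sublinear_bounds P -> sublinear_bounds Q ->
  (forall v a b, P v a -> Q v b -> 0 <= a + b) ->
  exists xi, (forall v a, P v a -> dotv xi v <= a) /\
             (forall v b, Q v b -> - dotv xi v <= b).
Proof.
move=> [PD PZ P0 Pex] [QD QZ Q0 Qex] PQ.
pose Z v := [set c | exists w a b, [/\ P (v + w) a, Q w b & c = a + b]].
have Zlb v : has_lbound (Z v).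
  have [a0 Pa0] := Pex (- v); exists (- a0) => _ [w [a [b [Pa Qb ->]]]].
  have := PD _ _ _ _ Pa0 Pa; rewrite addKr => Pw.
  by have := PQ _ _ _ Pw Qb; lra.
have Z0 v : Z v !=set0.
  have [a Pa] := Pex v; exists (a + 0), 0, a, 0.
  by split=> //; rewrite addr0.
pose h v := inf (Z v).
have hle v c : Z v c -> h v <= c by move=> vc; apply: ge_inf.
have [u v|t v t0||xi xih] := @sublinear_minorant h.
- rewrite -lerBlDr; apply: lb_le_inf => // _ [w [a [b [Pa Qb ->]]]].
  rewrite lerBlDr -lerBlDl; apply: lb_le_inf => // _ [w' [a' [b' [Pa' Qb' ->]]]].
  rewrite lerBlDl addrACA; apply: hle; exists (w + w'), (a + a'), (b + b').
  by split=> //; [rewrite addrACA; exact: PD|exact: QD].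
- rewrite -ler_pdivrMl//; apply: lb_le_inf => // _ [w [a [b [Pa Qb ->]]]].
  rewrite ler_pdivrMl// mulrDr; apply: hle; exists (t *: w), (t * a), (t * b).
  by split=> //; [rewrite -scalerDr; exact: PZ|exact: QZ].
- by apply: lb_le_inf => // _ [w [a [b [Pa Qb ->]]]]; apply: (PQ w);
  rewrite ?add0r in Pa *.
exists xi; split=> [v a Pa|v b Qb].
  apply: (le_trans (xih v)); rewrite -[a]addr0; apply: hle.
  by exists 0, a, 0; split=> //; rewrite addr0.
rewrite -dotvNr; apply: (le_trans (xih _)); rewrite -[b]add0r; apply: hle.
by exists v, 0, b; split=> //; rewrite addNr.
Qed.

End HahnBanach.

(** * Clarke derivatives *)
Section Clarke.
Context {R : realType} {n : nat}.
Implicit Types (F G : 'rV[R]_n -> R) (x y v w xi : 'rV[R]_n) (a b t e : R).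

(** The real number a bounds the difference quotients near x. Up to an arbitrarily
small change of a, this says that the Clarke derivative at x along v is at most a. *)
Definition clarke_bound F x v a := exists2 e : R, 0 < e &
  forall y t, `|y - x| < e -> 0 < t < e -> F (y + t *: v) - F y <= t * a.

Lemma clarke_bound_filter F x v a : clarke_bound F x v a ->
  (clarke_dderiv F x v <= a%:E)%E.
Proof.
move=> [e e0 Fe]; apply: ge_ereal_inf.
pose A : set ('rV[R]_n * R) := [set yt | `|yt.1 - x| < e /\ 0 < yt.2 < e].
exists (ereal_sup ((fun yt : 'rV[R]_n * R =>
    ((F (yt.1 + yt.2 *: v) - F yt.1) / yt.2)%:E) @` A)).
  exists A => //; exists (ball x e, [set t | 0 < t < e]) => /=.
    split; first exact: nbhsx_ballx.
    near=> t; apply/andP; split; near: t; first exact: nbhs_right_gt.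
    exact: nbhs_right_lt.
  by move=> [y t] /= [xy te]; split=> //=; move: xy; rewrite -ball_normE /= distrC.
apply: ge_ereal_sup => _ [[y t] [/= yx te] <-]; rewrite lee_fin.
by case/andP: (te) => t0 _; rewrite ler_pdivrMr// mulrC; exact: Fe.
Unshelve. all: by end_near. Qed.

Lemma clarke_bound_of_lt F x v a : (clarke_dderiv F x v < a%:E)%E ->
  exists2 b, b < a & clarke_bound F x v b.
Proof.
move=> /ereal_inf_lt[_ [A [[/= P Q] [/= /nbhs_ballP[e1 /= e10 eP] QF] PQA] <-]].
set s := ereal_sup _ => sa.
have [e2 /= e20 eQ] : nbhs_ball (0 : R) [set t | 0 < t -> Q t].
  by apply/nbhs_ballP; exact: QF.
have H b : (s <= b%:E)%E -> clarke_bound F x v b.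
  move=> sb; exists (Num.min e1 e2); first by rewrite lt_min e10.
  move=> y t; rewrite !lt_min => /andP[yx _] /and3P[t0 _ te2].
  rewrite mulrC -ler_pdivrMr// -lee_fin; apply: le_trans sb; apply: ereal_sup_ubound.
  exists (y, t) => //; apply: PQA; split=> /=.
    by apply: eP; rewrite -ball_normE /= distrC.
  by apply: eQ => //; rewrite -ball_normE /= sub0r normrN gtr0_norm.
case: s sa H => [r|//|] sa H.
- by exists r; [rewrite -lte_fin|exact: H].
- by exists (a - 1); [lra|apply: H; exact: leNye].
Qed.

Lemma clarke_subdiffP F x xi : clarke_subdiff F x xi <->
  forall v a, clarke_bound F x v a -> dotv xi v <= a.
Proof.
split=> [Fxi v a Fva|H v].
  by rewrite -lee_fin; apply: le_trans (Fxi v) (clarke_bound_filter Fva).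
by rewrite leNgt; apply/negP => /clarke_bound_of_lt[b ba /H]; rewrite leNgt ba.
Qed.

Lemma lipschitz_near F x : locally_lipschitz F ->
  exists L e : R, [/\ 0 < e, 0 < L & forall y z, `|y - x| < e -> `|z - x| < e ->
    `|F y - F z| <= L * `|y - z|].
Proof.
move=> /(_ x)[U /nbhs_ballP[e /= e0 eU]] /pinfty_ex_gt0[L L0 LU].
exists L, e; split=> // y z yx zx.
by apply: (LU (y, z)); split; apply: eU; rewrite -ball_normE /= distrC.
Qed.

Lemma locally_lipschitz_continuous F : locally_lipschitz F -> continuous F.
Proof.
move=> FL x; have [L [e [e0 L0 Le]]] := lipschitz_near x FL.
apply/(@cvgrPdist_lt _ _ _ (nbhs x)) => r r0; apply/nbhs_ballP.
exists (Num.min e (r / L)); first by rewrite /= lt_min e0 divr_gt0.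
move=> y; rewrite -ball_normE /= lt_min => /andP[ye yr].
have := Le x y; rewrite subrr normr0 e0 distrC => /(_ isT ye) /le_lt_trans; apply.
by rewrite mulrC -ltr_pdivlMr.
Qed.

(** Subadditivity: a step along u + v is a step along v followed by a step along u
from a displaced base point, which is still near x. *)
Lemma clarke_bound_sublinear F x : locally_lipschitz F ->
  sublinear_bounds (clarke_bound F x).
Proof.
move=> /(lipschitz_near x)[L [e [e0 L0 Le]]]; split.
- move=> u v a b [e1 e10 H1] [e2 e20 H2].
  have nv : 0 < 1 + `|v| by rewrite ltr_pwDl.
  exists (Num.min (e1 / (1 + `|v|)) e2); first by rewrite lt_min divr_gt0.
  move=> y t; rewrite !lt_min => /andP[ye1 ye2] /and3P[t0 te1 te2].
  have -> : F (y + t *: (u + v)) - F y =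
    (F (y + t *: v + t *: u) - F (y + t *: v)) + (F (y + t *: v) - F y).
    by rewrite scalerDr (addrC (t *: u)) addrA; ring.
  have e1n : e1 / (1 + `|v|) <= e1 by rewrite ler_pdivrMr// ler_peMr ?lerDl// ltW.
  rewrite mulrDr lerD//; last by apply: H2; rewrite ?t0.
  apply: H1; last by rewrite t0 (lt_le_trans te1).
  rewrite addrAC; apply: (le_lt_trans (ler_normD _ _)); rewrite normrZ gtr0_norm//.
  apply: (@lt_le_trans _ _ (e1 / (1 + `|v|) + e1 / (1 + `|v|) * `|v|)).
    by apply: ltr_leD => //; rewrite ler_wpM2r// ltW.
  by rewrite -{1}[e1 / _]mulr1 -mulrDr divfK ?gt_eqF.
- move=> s v a s0 [e1 e10 H1]; exists (Num.min e1 (e1 / s)).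
    by rewrite lt_min e10 divr_gt0.
  move=> y t; rewrite !lt_min => /andP[ye1 _] /and3P[t0 te1 te2].
  rewrite scalerA mulrA; apply: H1 => //; rewrite mulr_gt0//=.
  by rewrite -ltr_pdivlMr.
- by exists 1 => // y t _ _; rewrite scaler0 addr0 subrr mulr0.
move=> v; exists (L * `|v|).
have nv : 0 < 1 + `|v| by rewrite ltr_pwDl.
exists (Num.min (e / 2) (e / 2 / (1 + `|v|))); first by rewrite lt_min !divr_gt0.
move=> y t; rewrite !lt_min => /andP[ye _] /and3P[t0 _ te].
have tv : t * `|v| < e / 2.
  move: te; rewrite ltr_pdivlMr// mulrDr mulr1; apply: le_lt_trans; lra.
apply: (le_trans (ler_norm _)).
apply: (le_trans (Le _ _ _ _)).
- rewrite addrAC [ltRHS]splitr; apply: (le_lt_trans (ler_normD _ _)).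
  by rewrite normrZ gtr0_norm// ltrD.
- by apply: (lt_trans ye); lra.
by rewrite addrC addKr normrZ gtr0_norm// mulrCA.
Qed.

Lemma clarke_boundM F x v a b c d : clarke_bound F x v a -> 0 <= c ->
  d = c -> b = c * a -> clarke_bound (fun y => d * F y) x v b.
Proof.
move=> [e e0 H] c0 -> ->; exists e => // y t yx te.
by rewrite -mulrBr mulrCA ler_wpM2l//; exact: H.
Qed.

(** A step from y along - v is a step along v, reversed, from the base point
y - t v. *)
Lemma clarke_boundN F x v a : clarke_bound F x v a ->
  clarke_bound (fun y => - F y) x (- v) a.
Proof.
move=> [e e0 H]; have nv : 0 < 1 + `|v| by rewrite ltr_pwDl.
exists (Num.min (e / 2) (e / 2 / (1 + `|v|))); first by rewrite lt_min !divr_gt0.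
move=> y t; rewrite !lt_min => /andP[ye _] /and3P[t0 te1 te].
have tv : t * `|v| < e / 2.
  move: te; rewrite ltr_pdivlMr// mulrDr mulr1; apply: le_lt_trans; lra.
rewrite opprK addrC scalerN.
have := H (y - t *: v) t; rewrite subrK; apply; last by rewrite t0 /=; lra.
rewrite addrAC [ltRHS]splitr; apply: (le_lt_trans (ler_normB _ _)).
by rewrite normrZ gtr0_norm// ltrD.
Qed.

Lemma clarke_bound_add_ge0 F x v a b :
  clarke_bound F x v a -> clarke_bound (fun y => - F y) x v b -> 0 <= a + b.
Proof.
move=> [e e0 H] [e' e'0 H']; pose t := Num.min e e' / 2.
have m0 : 0 < Num.min e e' by rewrite lt_min e0.
have [te te'] : 0 < t < e /\ 0 < t < e'.
  have : Num.min e e' <= e by rewrite ge_min lexx.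
  have : Num.min e e' <= e' by rewrite ge_min lexx orbT.
  by rewrite /t; split; lra.
have := H x t; have := H' x t; rewrite subrr normr0 => /(_ e'0 te') h1 /(_ e0 te) h2.
have t0 : 0 < t by case/andP: te.
by rewrite -(pmulr_rge0 _ t0); lra.
Qed.

Lemma locally_lipschitzM F c : locally_lipschitz F -> locally_lipschitz (fun y =>
  c * F y).
Proof.
move=> FL x; have [L [e [e0 L0 Le]]] := lipschitz_near x FL.
exists (ball x e); first exact: nbhsx_ballx.
apply: (@klipschitzW _ _ _ (`|c| * L)).
  by apply: (@globally_properfilter _ _ (x, x)); split; exact: ballxx.
move=> [y z] [/= yx zx]; rewrite -mulrBr normrM -mulrA ler_wpM2l//.
by apply: Le; rewrite distrC; [move: yx|move: zx]; rewrite -ball_normE.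
Qed.

Lemma clarke_subdiff_nonempty G x : locally_lipschitz G ->
  clarke_subdiff G x !=set0.
Proof.
move=> GL; have GL' : locally_lipschitz (fun y => - G y).
  by have := locally_lipschitzM (-1) GL; under eq_fun do rewrite mulN1r.
have [v a b|xi [xiG _]] := sandwich (clarke_bound_sublinear x GL)
  (clarke_bound_sublinear x GL').
  exact: clarke_bound_add_ge0.
by exists xi; apply/clarke_subdiffP.
Qed.

(** If no direction v has a negative total bound, the sandwich theorem gives xi
below the Clarke derivative of F and - xi below that of - lambda G, that is, xi in
dF(x) and xi in lambda dG(x).
The sign of lambda matters in the second inclusion, and for lambda = 0 it needs a
point of dG(x). *)
Lemma descent_direction F G x lambda : locally_lipschitz F -> locally_lipschitz G ->
  ~ (clarke_subdiff F x `&` [set lambda *: eta | eta in clarke_subdiff G x] !=set0) ->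
  exists v a, a < 0 /\ clarke_bound (fun y => F y - lambda * G y) x v a.
Proof.
move=> FL GL noeig; apply: contrapT => nodesc; apply: noeig.
have GL' : locally_lipschitz (fun y => - lambda * G y) by exact: locally_lipschitzM.
have [v a b Fa Gb|xi [xiF xiG]] := sandwich (clarke_bound_sublinear x FL)
  (clarke_bound_sublinear x GL').
  rewrite leNgt; apply/negP => ab; apply: nodesc; exists v, (a + b); split=> //.
  move: Fa Gb => [e e0 H] [e' e'0 H']; exists (Num.min e e');
    first by rewrite lt_min e0.
  move=> y t; rewrite !lt_min => /andP[ye ye'] /and3P[t0 te te'].
  have := H y t ye; have := H' y t ye'; rewrite t0 te te' => /(_ isT) h1 /(_ isT) h2.
  by rewrite mulrDr; lra.
exists xi; split; first exact/clarke_subdiffP.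
have [l0|l0|l0] := ltgtP lambda 0.
- exists (lambda^-1 *: xi); last by rewrite scalerA mulfV ?lt_eqF// scale1r.
  apply/clarke_subdiffP => v a Ga; rewrite dotvZl.
  have := xiG v (- lambda * a) (clarke_boundM Ga _ erefl erefl).
  rewrite oppr_ge0 ltW// => /(_ isT); rewrite mulNr lerN2.
  by rewrite -ler_ndivrMl.
- exists (lambda^-1 *: xi); last by rewrite scalerA mulfV ?gt_eqF// scale1r.
  apply/clarke_subdiffP => v a Ga; rewrite dotvZl ler_pdivrMl//.
  have := xiG (- v) (lambda * a); rewrite dotvNr opprK; apply.
  have /(clarke_boundM (c := lambda)) := clarke_boundN Ga.
  move=> /(_ _ _ (ltW l0) erefl erefl).
  by congr clarke_bound; apply/funext => y; rewrite mulrN mulNr.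
have [eta etaG] := clarke_subdiff_nonempty x GL.
exists eta => //; rewrite l0 scale0r; apply/rowP => j; rewrite mxE.
have zb v : dotv xi v = 0.
  have b0 u : clarke_bound (fun y => - lambda * G y) x u 0.
    by exists 1 => // y t _ _; rewrite l0 oppr0 !mul0r mulr0 subrr.
  have := xiG v 0 (b0 v); have := xiG (- v) 0 (b0 _); rewrite dotvNr; lra.
have := zb (basis_vec j); rewrite /dotv (bigD1 j) //= mxE eqxx mulr1 big1 ?addr0// =>
  i ij.
by rewrite mxE (negbTE (_ : i != j :> nat)) ?mulr0.
Qed.

End Clarke.

(** * Euler's identity *)
Section Euler.
Context {R : realType} {n : nat}.
Implicit Types (F G : 'rV[R]_n -> R) (x y xi : 'rV[R]_n) (p lambda e : R).

Lemma powR_first_order p e : 0 < e -> exists2 d : R, 0 < d &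
  forall h : R, `|h| < d -> `|(1 + h) `^ p - 1 - p * h| <= e * `|h|.
Proof.
move=> e0; have D : is_derive (1 : R) 1 ((@powR R)^~ p) (p * 1 `^ (p - 1)).
  exact: is_derive1_powR.
have Dp : 'D_1 ((@powR R)^~ p) 1 = p.
  by rewrite (derive_val (is_derive := D)) powR1 mulr1.
have /cvgrPdist_le/(_ e e0) : h^-1 *: (((@powR R)^~ p \o shift 1) (h *: 1) - 1 `^ p)
    @[h --> 0^'] --> 'D_1 ((@powR R)^~ p) 1.
  by have [df _] := D; exact: df.
rewrite Dp powR1 => /nbhs_ballP[d /= d0 H]; exists d => // h hd.
have [->|h0] := eqVneq h 0; first by rewrite addr0 powR1 mulr0 subrr subr0 normr0 mulr0.
have := H h; rewrite /ball /= sub0r normrN => /(_ hd h0).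
rewrite /shift /= [_ *: 1]mulr1 -(ler_pM2r (_ : 0 < `|h|)) ?normr_gt0// -normrM.
rewrite mulrBl [_ *: _ * _]mulrAC mulVf// mul1r distrC (addrC h) //.
Qed.

(** Compare y + h x with (1 + h) y: they differ by h (x - y), which is o(h) as y tends
to x, and F is known exactly at the latter by homogeneity. *)
Lemma homogeneous_first_order p F x e : homogeneous p F -> locally_lipschitz F ->
  0 < e -> exists2 d : R, 0 < d & forall y (h : R), `|y - x| < d -> `|h| < d ->
    F (y + h *: x) - F y <= p * F x * h + e * `|h|.
Proof.
move=> Fh FL e0; have [L [r [r0 L0 Lr]]] := lipschitz_near x FL.
pose M : R := `|F x| + L * r + 1.
have Lr0 : 0 < L * r by exact: mulr_gt0.
have M0 : 0 < M by rewrite ltr_wpDl// addr_ge0// ltW.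
have [d1 d10 H1] := powR_first_order p (divr_gt0 e0 (mulr_gt0 (ltr0n R 2) M0)).
have p1 : 0 < 1 + `|p| by rewrite ltr_pwDl.
have x2 : 0 < 2 + `|x| by rewrite ltr_pwDl.
pose d : R := Num.min (Num.min d1 (2^-1))
  (Num.min (r / 2 / (2 + `|x|)) (e / 2 / (L * (1 + `|p|)))).
exists d; first by rewrite !lt_min d10 invr_gt0 ltr0n /= !divr_gt0 ?mulr_gt0.
move=> y h; rewrite !lt_min =>
  /andP[/andP[_ y1] /andP[yr yd]] /andP[/andP[hd1 h1] /andP[hr hd]].
have r2 : r / 2 / (2 + `|x|) <= r / 2.
  by rewrite ler_pdivrMr// ler_peMr ?divr_ge0// ?ltW//; have := normr_ge0 x; lra.
have hx : `|h| * (1 + `|x|) < r / 2.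
  move: hr; rewrite ltr_pdivlMr//; have := normr_ge0 h. nra.
have yx : `|y| <= 1 + `|x|.
  have := ler_normD x (y - x); rewrite subrKC; lra.
have near1 : `|y + h *: x - x| < r.
  rewrite addrAC; apply: (le_lt_trans (ler_normD _ _)); rewrite normrZ.
  by have := normr_ge0 h; nra.
have near2 : `|(1 + h) *: y - x| < r.
  rewrite scalerDl scale1r addrAC; apply: (le_lt_trans (ler_normD _ _)); rewrite normrZ.
  by have := normr_ge0 h; nra.
have Fhy : F ((1 + h) *: y) = (1 + h) `^ p * F y.
  by apply: Fh; move: h1; rewrite ltr_norml; lra.
have E1 : `|F (y + h *: x) - F ((1 + h) *: y)| <= `|h| * (L * `|y - x|).
  apply: (le_trans (Lr _ _ near1 near2)).
  have -> : y + h *: x - (1 + h) *: y = h *: (x - y).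
    by rewrite scalerDl scale1r scalerBr opprD addrACA subrr add0r.
  by rewrite normrZ distrC mulrCA.
have yr' : `|y - x| < r by lra.
have xr' : `|x - x| < r by rewrite subrr normr0.
have E2 : `|F y - F x| <= L * `|y - x| by exact: Lr.
have E3 : `|F y| <= M.
  have := ler_normD (F x) (F y - F x); rewrite subrKC.
  have : L * `|y - x| <= L * r by rewrite ler_pM2l// ltW.
  rewrite /M; lra.
have E4 : `|((1 + h) `^ p - 1 - p * h) * F y| <= e / 2 * `|h|.
  rewrite normrM; apply: (@le_trans _ _ (e / (2 * M) * `|h| * M)).
    by apply: ler_pM => //; exact: H1.
  rewrite (_ : _ * M = e / 2 * `|h|) ?lexx//; field.
  by rewrite gt_eqF.
have E5 : `|p * h * (F y - F x)| <= `|h| * (`|p| * (L * `|y - x|)).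
  by rewrite !normrM -mulrA mulrCA ler_wpM2l// ler_wpM2l.
have E6 : `|h| * (L * `|y - x|) + `|h| * (`|p| * (L * `|y - x|)) <= `|h| * (e / 2).
  rewrite -mulrDr ler_wpM2l//.
  have -> : L * `|y - x| + `|p| * (L * `|y - x|) = `|y - x| * (L * (1 + `|p|)) by ring.
  by move: yd; rewrite ltr_pdivlMr ?mulr_gt0//; exact: ltW.
have -> : F (y + h *: x) - F y = (F (y + h *: x) - F ((1 + h) *: y)) +
    ((1 + h) `^ p - 1 - p * h) * F y + p * h * (F y - F x) + p * F x * h.
  by rewrite Fhy; ring.
have := le_trans (ler_norm _) E1; have := le_trans (ler_norm _) E4.
have := le_trans (ler_norm _) E5; lra.
Qed.

Lemma clarke_bound_radial p F x e (s : R) : homogeneous p F -> locally_lipschitz F ->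
  0 < e -> `|s| = 1 -> clarke_bound F x (s *: x) (s * (p * F x) + e).
Proof.
move=> Fh FL e0 s1; have [d d0 H] := homogeneous_first_order x Fh FL e0.
exists d => // y t yx /andP[t0 td]; rewrite scalerA.
have := H y (t * s) yx; rewrite normrM s1 mulr1 gtr0_norm// => /(_ td); lra.
Qed.

(** The Clarke derivatives at x along x and - x are p F(x) and - p F(x), so every
subgradient takes the same value at x. *)
Lemma euler_subdiff p F x xi : homogeneous p F -> locally_lipschitz F ->
  clarke_subdiff F x xi -> dotv xi x = p * F x.
Proof.
move=> Fh FL /clarke_subdiffP xiF; apply/eqP; rewrite eq_le; apply/andP; split.
  apply/ler_addgt0Pr => e e0; rewrite -[p * F x]mul1r; apply: xiF.
  by rewrite -[X in clarke_bound _ _ X]scale1r; apply: clarke_bound_radial;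
    rewrite ?normr1.
apply/ler_addgt0Pr => e e0; rewrite -lerBlDr -lerN2 -dotvNr opprB.
have -> : e - p * F x = -1 * (p * F x) + e by ring.
by apply: xiF; rewrite -scaleN1r; apply: clarke_bound_radial; rewrite ?normrN ?normr1.
Qed.

End Euler.

(** * Odd extensions and odd deformations *)
Section OddExtension.
Context {R : realType} {n : nat}.

(** Extend each coordinate by Tietze's theorem, then keep the odd part. *)
Lemma odd_extension (A : set 'rV[R]_n) s (f : 'rV[R]_n -> 'rV[R]_s) :
  closed A -> symmetric_set A -> {within A, continuous f} ->
  (forall x, A x -> f (- x) = - f x) -> (forall x, A x -> unit_sphere (f x)) ->
  exists g : 'rV[R]_n -> 'rV[R]_s, [/\ continuous g,
    forall x, g (- x) = - g x & forall x, A x -> g x = f x].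
Proof.
move=> Acl Asym fc fo fS.
have ext j : exists g : 'rV[R]_n -> R, continuous g /\ forall x, A x -> g x = f x 0 j.
  have fjc : {within A, continuous (fun x => f x 0 j)}.
    apply: (@within_continuous_comp _ _ _ A f (fun y : 'rV[R]_s => y 0 j)) fc => y _.
    exact: coord_continuous.
  have f1 x : A x -> `|f x 0 j| <= 1.
    move=> /fS; rewrite /unit_sphere /= => S1.
    rewrite -(ler_pXn2r (n := 2)) ?nnegrE//= expr1n real_normK ?num_real//.
    by rewrite -S1 (bigD1 j) //= lerDl sumr_ge0// => i _; exact: sqr_ge0.
  have [g [gf gc _]] := continuous_bounded_extension
    (pseudometric_normal (X := 'rV[R]_n)) Acl ltr01 fjc f1.
  by exists g; split=> // x Ax; rewrite gf// inE.
have [g gP] := choice ext.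
exists (fun x => \row_j (2^-1 * (g j x - g j (- x)))); split.
- move=> x; apply: (@cvg_row _ _ (nbhs x)) => j.
  rewrite mxE; under eq_cvg do rewrite mxE.
  have gx y : g j z @[z --> y] --> g j y by case: (gP j) => + _; apply.
  apply: (@cvgM _ _ (nbhs x)); first exact: cvg_cst.
  apply: (@cvgB _ _ _ (nbhs x)); first exact: gx.
  apply: (@continuous_comp _ _ _ (fun y : 'rV[R]_n => - y) (g j)); last exact: gx.
  exact: opp_continuous.
- by move=> x; apply/rowP => j; rewrite !mxE opprK; ring.
- move=> x Ax; apply/rowP => j; rewrite mxE (gP j).2// (gP j).2; last exact: Asym.
  by rewrite fo// mxE; field.
Qed.

End OddExtension.

Section Deformation.
Context {R : realType} {n : nat} {Phi : 'rV[R]_n -> R}.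
Context (Phi_continuous : continuous Phi) (Phi_even : even_fun Phi).
Implicit Types (x y v : 'rV[R]_n) (theta : 'rV[R]_n -> 'rV[R]_n).

(** Uniformity in the base point y makes this an open condition on x. *)
Definition descends x := exists v (e : R), 0 < e /\
  forall y t, `|y - x| < e -> 0 < t < e -> Phi (y + t *: v) < Phi y.

(** Since every point is either fixed or strictly improved, such maps can be composed
and the composite improves every point that one of them improves. *)
Definition odd_descent theta := [/\ continuous theta,
  forall y, theta (- y) = - theta y & forall y, theta y = y \/ Phi (theta y) < Phi y].

Lemma open_descends : open descends.
Proof.
rewrite openE => x [v [e [e0 H]]]; apply/nbhs_ballP; exists (e / 2) => /=.
  by rewrite divr_gt0.
move=> z; rewrite -ball_normE /= => xz; exists v, (e / 2); split;
  first by rewrite divr_gt0.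
move=> y t yz /andP[t0 te]; apply: H; last by rewrite t0; lra.
by apply: (le_lt_trans (ler_distD z y x)); rewrite [ltRHS]splitr ltrD// distrC.
Qed.

Lemma odd_descent_comp theta1 theta2 : odd_descent theta1 -> odd_descent theta2 ->
  odd_descent (theta2 \o theta1) /\ forall y,
    Phi (theta1 y) < Phi y \/ Phi (theta2 y) < Phi y -> Phi (theta2 (theta1 y)) < Phi y.
Proof.
move=> [c1 o1 d1] [c2 o2 d2]; split; first split.
- by move=> y; apply: continuous_comp; [exact: c1|exact: c2].
- by move=> y /=; rewrite o1 o2.
- move=> y /=; case: (d1 y) => [->|dy1]; first exact: d2.
  by right; case: (d2 (theta1 y)) => [->//|/lt_trans]; apply.
move=> y; case: (d1 y) => [->|dy1 _]; first by case=> //; rewrite ltxx.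
by case: (d2 (theta1 y)) => [->//|/lt_trans]; apply.
Qed.

(** Push along v with a bump around x, and along - v with the opposite bump around - x.
The radius is so small compared with |x| that the two bumps have disjoint
supports, so only one of the two moves is active at a time. *)
Lemma odd_descent_local x : x != 0 -> descends x ->
  exists theta, odd_descent theta /\ Phi (theta x) < Phi x.
Proof.
move=> x0 [v [e [e0 H]]].
pose r : R := Num.min e `|x| / 2.
have m0 : 0 < Num.min e `|x| by rewrite lt_min e0 normr_gt0.
have r0 : 0 < r by rewrite divr_gt0.
have [re rx] : r < e /\ r + r <= `|x|.
  have : Num.min e `|x| <= e by rewrite ge_min lexx.
  have : Num.min e `|x| <= `|x| by rewrite ge_min lexx orbT.
  by rewrite /r; split; lra.
pose psi y : R := Num.max 0 (r - `|y - x|).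
have psi_ge0 y : 0 <= psi y by rewrite le_max lexx.
have psi_lt y : psi y < e by rewrite gt_max e0 /=; have := normr_ge0 (y - x); lra.
have psi_gt0 y : 0 < psi y -> `|y - x| < r by rewrite lt_max ltxx subr_gt0.
have psic : continuous psi.
  move=> y; apply: (@continuous_comp _ _ _ (fun y => r - `|y - x|) (Num.max 0)).
    apply: (@cvgB _ _ _ (nbhs y)); first exact: cvg_cst.
    apply: (@continuous_comp _ _ _ (fun y => y - x) (fun y => `|y|)).
      by apply: (@cvgB _ _ _ (nbhs y)); [exact: cvg_id|exact: cvg_cst].
    exact: norm_continuous.
  by apply: (@continuous_max _ _ (cst 0) id); [exact: cvg_cst|exact: cvg_id].
have psi_opp y : 0 < psi y -> psi (- y) = 0.
  move=> /psi_gt0 yx; apply/eqP; rewrite eq_le psi_ge0 andbT leNgt; apply/negP =>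
    /psi_gt0.
  have := ler_normD (y - x) (- y - x).
  rewrite addrACA subrr add0r -opprD normrN -mulr2n normrMn mulr2n; lra.
exists (fun y => y + (psi y - psi (- y)) *: v); split; first split.
- move=> y; apply: (@cvgD _ _ _ (nbhs y)); first exact: cvg_id.
  apply: (@cvgZ _ _ _ (nbhs y)); last exact: cvg_cst.
  apply: (@cvgB _ _ _ (nbhs y)); first exact: psic.
  apply: (@continuous_comp _ _ _ (fun y : 'rV[R]_n => - y) psi); last exact: psic.
  exact: opp_continuous.
- by move=> y; rewrite opprK opprD -scaleNr opprB.
- move=> y; have [y0|] := ltP 0 (psi y).
    right; rewrite psi_opp// subr0; apply: H; last by rewrite y0 psi_lt.
    exact: lt_trans (psi_gt0 _ y0) re.
  rewrite le_eqVlt ltNge psi_ge0 orbF => /eqP ->; rewrite sub0r.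
  have [y0|] := ltP 0 (psi (- y)).
    right; rewrite -[X in X < _]Phi_even -[X in _ < X]Phi_even opprD -scaleNr opprK.
    apply: H; last by rewrite y0 psi_lt.
    exact: lt_trans (psi_gt0 _ y0) re.
  by rewrite le_eqVlt ltNge psi_ge0 orbF => /eqP ->; left; rewrite oppr0 scale0r addr0.
have px : 0 < psi x by rewrite lt_max subrr normr0 subr0 r0 orbT.
by rewrite psi_opp// subr0; apply: H; rewrite ?subrr ?normr0// px psi_lt.
Qed.

(** Finitely many local moves cover L; composing them improves every point
of L by [odd_descent_comp]. *)
Lemma odd_descent_compact (L : set 'rV[R]_n) : compact L ->
  (forall x, L x -> x != 0 /\ descends x) ->
  exists theta, odd_descent theta /\ forall x, L x -> Phi (theta x) < Phi x.
Proof.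
rewrite compact_cover => cL LP.
have ex x : exists theta, L x -> odd_descent theta /\ Phi (theta x) < Phi x.
  have [Lx|] := pselect (L x); last by exists id.
  by have [x0 dx] := LP x Lx; have [theta th] := odd_descent_local x0 dx; exists theta.
have [Th ThP] := choice ex.
have [x Lx|x Lx|D DL LD] := cL 'rV[R]_n L (fun x => [set y | Phi (Th x y) < Phi y]).
- have [[c _ _] _] := ThP x Lx.
  have -> : [set y | Phi (Th x y) < Phi y] = (fun y =>
    Phi y - Phi (Th x y)) @^-1` [set t | 0 < t].
    by apply/seteqP; split=> y /=; rewrite subr_gt0.
  apply: open_comp; last exact: open_gt.
  move=> y _; apply: (@cvgB _ _ _ (nbhs y)); first exact: Phi_continuous.
  by apply: (@continuous_comp _ _ _ (Th x) Phi); [exact: c|exact: Phi_continuous].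
- by exists x => //=; have [] := ThP x Lx.
have : forall x, x \in finmap.enum_fset D -> odd_descent (Th x).
  by move=> x /DL; rewrite inE => /ThP[].
move=> ThD; suff [theta [thP thD]] : exists theta, odd_descent theta /\
    forall x y, x \in finmap.enum_fset D -> Phi (Th x y) < Phi y ->
      Phi (theta y) < Phi y.
  by exists theta; split=> // y /LD[x xD]; apply: thD.
elim: (finmap.enum_fset D) ThD => [|x s IHs] ThD.
  by exists id; split=> //; split=> [y||y]; [exact: cvg_id|by []|left].
have [|theta [thP ths]] := IHs; first by move=> y ys; apply: ThD; rewrite inE ys orbT.
have [cP cD] := odd_descent_comp thP (ThD x (mem_head _ _)).
exists (Th x \o theta); split=> // z y; rewrite inE => /orP[/eqP->|/ths zs] zy.
  by apply: cD; right.
by apply: cD; left; exact: zs.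
Qed.

End Deformation.

(** * The multiplicity theorem *)
Section LusternikSchnirelmann.
Context {R : realType} {n : nat} {F G : 'rV[R]_n -> R}.
Local Notation q := (fun x => F x / G x).
Local Notation lam := (minmax_eigenvalue F G).
Context (F_even : even_fun F) (G_even : even_fun G)
  (F_lip : locally_lipschitz F) (G_lip : locally_lipschitz G)
  (qP : rayleigh_regular (F := F) (G := G)).

Lemma within_continuous_row_mx (T : topologicalType) (A : set T) k m
    (f : T -> 'rV[R]_k) (g : T -> 'rV[R]_m) :
  {within A, continuous f} -> {within A, continuous g} ->
  {within A, continuous (fun x => row_mx (f x) (g x))}.
Proof.
move=> /subspace_continuousP fA /subspace_continuousP gA.
apply/subspace_continuousP => x Ax; apply: cvg_row => j.
case: (split_ordP j) => i ->.
  rewrite row_mxEl; under eq_cvg do rewrite row_mxEl.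
  apply: (cvg_comp f (fun y : 'rV[R]_k => y 0 i) (fA _ Ax)).
  exact: coord_continuous.
rewrite row_mxEr; under eq_cvg do rewrite row_mxEr.
apply: (cvg_comp g (fun y : 'rV[R]_m => y 0 i) (gA _ Ax)).
exact: coord_continuous.
Qed.

(** For s = -1 the direction is reversed: Phi decreases along v uniformly near x
exactly when - Phi decreases along - v uniformly near x. *)
Lemma descends_non_eigenvector (s c : R) x : s = 1 \/ s = -1 -> x != 0 ->
  ~ eigenpair F G c x -> descends (Phi := fun y => s * (F y - c * G y)) x.
Proof.
move=> s1 x0 noeig.
have [|v [a [a0 Fa]]] := @descent_direction _ _ F G x c F_lip G_lip.
  by move=> eig; apply: noeig.
have desc (Psi : 'rV[R]_n -> R) w : clarke_bound Psi x w a -> descends (Phi := Psi) x.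
  move=> [e e0 H]; exists w, e; split=> // y t yx te.
  have := H y t yx te; have : t * a < 0 by case/andP: te => t0 _; rewrite nmulr_llt0.
  lra.
case: s1 => ->.
  by apply: (desc _ v); case: Fa => e e0 H; exists e => // y t yx te; rewrite !mul1r;
    exact: H.
apply: (desc _ (- v)); have [e e0 H] := clarke_boundN Fa.
by exists e => // y t yx te; rewrite !mulN1r; exact: H.
Qed.

Lemma descendsN (Phi : 'rV[R]_n -> R) x : even_fun Phi ->
  descends (Phi := Phi) (- x) -> descends (Phi := Phi) x.
Proof.
move=> Pe [v [e [e0 H]]]; exists (- v), e; split=> // y t yx te.
have := H (- y) t; rewrite -opprD normrN => /(_ yx te).
by rewrite scalerN -[X in X < _]Pe opprD opprK Pe.
Qed.

(** The number s is the sign of G. The condition at 0 makes Phi vanish there, so that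
points with Phi < 0 are nonzero. Tietze's theorem is applied on the compact
set K of unit vectors on the level q = c where Phi does not descend: they are
eigenvectors of c. *)
Lemma minmax_multiplicity (s c : R) j r : s = 1 \/ s = -1 ->
  (forall x, x != 0 -> 0 < s * G x) -> F 0 = c * G 0 ->
  (0 < j)%N -> (j + r <= n)%N ->
  odd_nonvanishing [set x | eigenpair F G c x] r ->
  lam (j + r) <= c -> lam j < c.
Proof.
move=> s1 sG F0 j0 jr eigr lamc.
have n0 : (0 < n)%N by lia.
pose Phi y := s * (F y - c * G y).
have Phic : continuous Phi.
  move=> x; apply: (@cvgM _ _ (nbhs x)); first exact: cvg_cst.
  apply: (@cvgB _ _ _ (nbhs x)); first exact: locally_lipschitz_continuous.
  by apply: (@cvgM _ _ (nbhs x)); [exact: cvg_cst|exact: locally_lipschitz_continuous].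
have Phie : even_fun Phi by move=> x; rewrite /Phi F_even G_even.
have Phi0 : Phi 0 = 0 by rewrite /Phi F0 subrr mulr0.
have Phiq x : x != 0 -> Phi x = (q x - c) * (s * G x).
  move=> x0; have G0 : G x != 0.
    by have := sG x x0; apply: contraTneq => ->; rewrite mulr0 ltxx.
  by rewrite /Phi; field.
have q_lt x : x != 0 -> Phi x < 0 -> q x < c.
  by move=> x0; rewrite Phiq// pmulr_llt0 ?sG// subr_lt0.
have q_gt x : x != 0 -> 0 < Phi x -> c < q x.
  by move=> x0; rewrite Phiq// pmulr_lgt0 ?sG// subr_gt0.
have Sn0 (x : 'rV[R]_n) : `|x| = 1 -> x != 0 by move=> x1; rewrite -normr_gt0 x1.
pose K : set 'rV[R]_n := [set x | `|x| = 1] `&` Phi @^-1` [set 0] `&`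
  ~` descends (Phi := Phi).
have Seq (T : topologicalType) (f : T -> R) : continuous f -> closed (f @^-1` [set 0]).
  by move=> fc; apply: closed_comp; [move=> *; exact: fc|exact: closed_eq].
have Kcl : closed K.
  apply: closedI; last by apply: open_closedC; exact: open_descends.
  apply: closedI; last exact: Seq.
  by apply: compact_closed; [exact: norm_hausdorff|exact: compact_norm1].
have Ksym : symmetric_set K.
  move=> x [[/= x1 Px] xd]; split; first by split; rewrite /= ?normrN ?Phie.
  by move=> xd'; apply: xd; exact: descendsN.
have KE : K `<=` [set x | eigenpair F G c x].
  move=> x [[/= x1 Px] xd]; apply: contrapT => noeig; apply: xd.
  by apply: descends_non_eigenvector => //; exact: Sn0.
have [h [hc ho hS]] := (odd_nonvanishingP _ _).1 eigr.
have [H [Hc Ho HK]] := odd_extension Kcl Ksym (continuous_subspaceW KE hc)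
  (fun x Kx => ho x (KE x Kx)) (fun x Kx => hS x (KE x Kx)).
pose HZ : set 'rV[R]_n := H @^-1` [set 0].
have HZcl : closed HZ.
  apply: closed_comp; first by move=> *; exact: Hc.
  by apply: compact_closed; [exact: norm_hausdorff|exact: compact_set1].
have [|x [[x1 Px] Hx]|theta [[tc to td] tL]] := odd_descent_compact Phic Phie
    (L := [set x | `|x| = 1] `&` Phi @^-1` [set 0] `&` HZ).
- apply: compact_closedI => //; apply: compact_closedI; last exact: Seq.
  exact: compact_norm1.
- split; first exact: Sn0.
  apply: contrapT => nd; have Kx : K x by [].
  have := hS x (KE x Kx); rewrite -(HK x Kx) Hx /unit_sphere /=.
  by rewrite big1 => [/esym/eqP|i _]; rewrite ?oner_eq0// mxE expr0n.
have Ptc : continuous (Phi \o theta).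
  by move=> x; apply: continuous_comp; [exact: tc|exact: Phic].
(* The points with H = 0 that theta fails to bring below the level c are strictly
   above it, hence by compactness above some c' > c. *)
pose Z : set 'rV[R]_n := [set x | `|x| = 1] `&` HZ `&`
  (Phi \o theta) @^-1` [set t | 0 <= t].
have Zc : compact Z.
  apply: compact_closedI; last by apply: closed_comp; [move=> *;
    exact: Ptc|exact: closed_ge].
  by apply: compact_closedI => //; exact: compact_norm1.
have Zq y : Z y -> c < q y.
  move=> [[/= y1 Hy] Py]; apply: q_gt; first exact: Sn0.
  have Py' : 0 <= Phi y by case: (td y) => [<-//|/ltW]; exact: le_trans.
  rewrite lt_neqAle Py' andbT eq_sym; apply/eqP => Py0.
  by have := tL y (conj (conj y1 Py0) Hy); rewrite ltNge Py0 => /negP; apply.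
have [c' cc' Zc'] : exists2 c', c < c' & forall y, Z y -> c' <= q y.
  have [Z0|/set0P Z0] := eqVneq Z set0.
    by exists (c + 1); [rewrite ltrDl|rewrite Z0].
  have qZ : {within Z, continuous q}.
    by apply: continuous_subspaceW qP.1 => y [[y1 _] _]; exact: Sn0.
  have [z zZ zmin] := compact_EVT_min Z0 Zc qZ.
  exists (q z); first by apply: Zq; rewrite inE in zZ.
  by move=> y Zy; apply: zmin; rewrite inE.
have [A Ajr Ac'] := minmax_lt qP n0 jr (le_lt_trans lamc cc').
have [Ac Asym A0 nA0 gA] := Ajr.
have An0 x : A x -> x != 0 by exact: nonzero_of_admissible Ajr.
have nuc : {within A, continuous (@normalize R n)}.
  by apply: continuous_subspaceW (@continuous_normalize R n) => x; exact: An0.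
pose C := (@normalize R n @` A) `&` HZ.
have Cneg y : C y -> Phi (theta y) < 0.
  move=> [[x Ax <-] Hx]; rewrite ltNge; apply/negP => P0.
  have /Zc' : Z (normalize x).
    by split=> //; split=> //; apply: norm_normalize; exact: An0.
  by rewrite (rayleigh_normalize qP) ?An0// leNgt Ac'.
have C0 : C !=set0.
  apply/set0P/eqP => Cempty; suff : (genus A <= r)%N by lia.
  apply: genus_le => //; exists (H \o @normalize R n); split.
  - by apply: within_continuous_comp nuc => x _; exact: Hc.
  - by move=> x Ax /=; rewrite normalizeN Ho.
  - move=> x Ax /=; apply/eqP => Hx; suff : C (normalize x) by rewrite Cempty.
    by split=> //; exists x.
have Bj : admissible j (theta @` C).
  have Bsym : symmetric_set (theta @` C).
    move=> _ [_ [[x Ax <-] Hx] <-]; exists (normalize (- x));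
      last by rewrite normalizeN to.
    split; first by exists (- x) => //; exact: Asym.
    by rewrite /HZ /= normalizeN Ho Hx oppr0.
  have Bc : compact (theta @` C).
    apply: continuous_compact; first by apply: continuous_subspaceT; exact: tc.
    by apply: compact_closedI => //; exact: continuous_compact.
  have B0 : theta @` C !=set0 by case: C0 => y Cy; exists (theta y), y.
  have nB0 : ~ (theta @` C) 0.
    by move=> [y Cy ty]; have := Cneg y Cy; rewrite ty Phi0 ltxx.
  split=> //; rewrite leqNgt; apply/negP => gB.
  have /odd_nonvanishingP[f [fc fo fS]] := genus_attained B0 nB0.
  have Bcl : closed (theta @` C) by apply: compact_closed => //; exact: norm_hausdorff.
  have [g [gc go gB']] := odd_extension Bcl Bsym fc fo fS.
  (* On A, either H is nonzero or the point is sent by theta into B. *)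
  suff : (genus A <= r + genus (theta @` C))%N by lia.
  apply: genus_le => //.
  exists (fun x => row_mx (H (normalize x)) (g (theta (normalize x)))); split.
  - apply: within_continuous_row_mx.
      by apply: (@within_continuous_comp _ _ _ A (@normalize R n) H) nuc => x _;
        exact: Hc.
    apply: (@within_continuous_comp _ _ _ A (@normalize R n) (g \o theta)) nuc => x _.
    by apply: continuous_comp; [exact: tc|exact: gc].
  - by move=> x Ax; rewrite normalizeN Ho to go -opp_row_mx.
  - move=> x Ax; apply/eqP; rewrite -[0]row_mx0 => /eq_row_mx[Hx gx].
    have Bx : (theta @` C) (theta (normalize x)).
      by exists (normalize x) => //; split=> //; exists x.
    have := fS _ Bx; rewrite -gB'// gx /unit_sphere /=.
    by rewrite big1 => [/esym/eqP|i _]; rewrite ?oner_eq0// mxE expr0n.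
have [x [[y Cy yx] _ xmax]] := admissible_sup qP Bj.
apply: (le_lt_trans (minmax_le qP Bj xmax)); apply: q_lt; last by rewrite -yx Cneg.
by apply: (nonzero_of_admissible Bj); exists y.
Qed.

End LusternikSchnirelmann.

(** * Homogeneous pairs *)
Section HomogeneousPairs.
Context {R : realType} {n : nat}.
Implicit Types (F G : 'rV[R]_n -> R) (x y : 'rV[R]_n) (p c : R).

Lemma homogeneous0_const F x : homogeneous 0 F -> continuous F -> F x = F 0.
Proof.
move=> Fh Fc; apply: contrapT => /eqP; rewrite -subr_eq0 -normr_gt0 => d0.
have /cvgrPdist_lt/(_ _ d0)/nbhs_ballP[e /= e0 H] := Fc 0.
have x1 : 0 < 1 + `|x| by rewrite ltr_pwDl.
have t0 : 0 < e / (1 + `|x|) by rewrite divr_gt0.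
have := H ((e / (1 + `|x|)) *: x); rewrite Fh// powRr0 mul1r distrC ltxx => Hb;
  suff: false by []; apply: Hb.
rewrite -ball_normE /= sub0r normrN normrZ gtr0_norm// mulrAC ltr_pdivrMr//.
by rewrite ltr_pM2l// ltrDr.
Qed.

Lemma homogeneous_at0 p F : p != 0 -> homogeneous p F -> F 0 = 0.
Proof.
move=> p0 Fh; have := Fh 2 0 (ltr0n R 2); rewrite scaler0.
have p2 : 2 `^ p != 1 :> R.
  apply: contra_neq p0 => p2; have := ln_powR 2 p; rewrite p2 ln1 => /esym/eqP.
  by rewrite mulf_eq0 => /orP[/eqP//|]; rewrite gt_eqF// ln_gt0// ltr1n.
move=> /eqP; rewrite -subr_eq0 -{1}[F 0]mul1r -mulrBl mulf_eq0 subr_eq0.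
by rewrite eq_sym (negbTE p2) => /eqP.
Qed.

Lemma rayleigh_regular_homogeneous p F G : homogeneous p F -> homogeneous p G ->
  continuous F -> continuous G -> (forall x, x != 0 -> G x != 0) ->
  rayleigh_regular (F := F) (G := G).
Proof.
move=> Fh Gh Fc Gc G0; split.
  apply/subspace_continuousP => x /= x0; apply: cvg_within_filter.
  apply: (@cvgM _ _ (nbhs x)); first exact: Fc.
  by apply: (@cvgV _ _ (nbhs x)); [exact: G0|exact: Gc].
move=> t x t0; rewrite Fh// Gh// -mulf_div divff ?mul1r//.
by rewrite gt_eqF// powR_gt0.
Qed.

(** A segment from a point where G < 0 to one where G > 0 must pass through 0, so the
two points are opposite up to a positive factor, against evenness. *)
Lemma nonvanishing_sign p G : even_fun G -> homogeneous p G -> continuous G ->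
  (forall x, x != 0 -> G x != 0) ->
  exists s : R, (s = 1 \/ s = -1) /\ forall x, x != 0 -> 0 < s * G x.
Proof.
move=> Ge Gh Gc G0.
have [Gpos|] := pselect (forall x, x != 0 -> 0 < G x).
  by exists 1; split; [left|move=> x; rewrite mul1r; exact: Gpos].
move=> /existsNP[x /not_implyP[x0 /negP]];
  rewrite -leNgt le_eqVlt (negbTE (G0 x x0)) /=.
move=> Gx; exists (-1); split=> [|y y0]; first by right.
rewrite mulN1r oppr_gt0 ltNge; apply/negP => Gy.
pose g (t : R) := G ((1 - t) *: x + t *: y).
have gc : continuous g.
  move=> t; apply: (@continuous_comp _ _ _ (fun t : R => (1 - t) *: x + t *: y) G);
    last exact: Gc.
  apply: cvgD; apply: cvgZ; [|exact: cvg_cst|exact: cvg_id|exact: cvg_cst].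
  by apply: cvgB; [exact: cvg_cst|exact: cvg_id].
have g01 : Num.min (g 0) (g 1) <= 0 <= Num.max (g 0) (g 1).
  rewrite /g subr0 subrr !scale1r !scale0r addr0 add0r.
  by rewrite ge_min le_max Gy (ltW Gx) orbT.
have [t] := IVT ler01 (continuous_subspaceT gc) g01.
rewrite in_itv /= => /andP[t0 t1] /eqP gt0.
have {gt0} xy : (1 - t) *: x + t *: y = 0.
  by apply/eqP; apply: contraTT gt0; exact: G0.
have t_lt1 : t < 1.
  rewrite lt_neqAle t1 andbT; apply/eqP => t_1; move: xy.
  by rewrite t_1 subrr scale0r scale1r add0r => /eqP; rewrite (negbTE y0).
have t_gt0 : 0 < t.
  rewrite lt_neqAle t0 andbT eq_sym; apply/eqP => t_0; move: xy.
  by rewrite t_0 subr0 scale0r scale1r addr0 => /eqP; rewrite (negbTE x0).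
have s0 : 0 < 1 - t by rewrite subr_gt0.
have /(congr1 G) : (1 - t) *: x = - (t *: y) by apply/eqP; rewrite -addr_eq0 xy.
rewrite Ge !Gh// => E; have : (1 - t) `^ p * G x < 0 by rewrite pmulr_rlt0 ?powR_gt0.
by rewrite E ltNge mulr_ge0 ?powR_ge0.
Qed.

(** For p = 0 Euler's identity is void, but then F and G are constant and q takes
a single value. *)
Lemma eigenpair_rayleigh p F G k x : homogeneous p F -> homogeneous p G ->
  locally_lipschitz F -> locally_lipschitz G -> (forall x, x != 0 -> G x != 0) ->
  (0 < n)%N -> (k <= n)%N ->
  eigenpair F G (minmax_eigenvalue F G k) x ->
  F x / G x = minmax_eigenvalue F G k /\ F 0 = minmax_eigenvalue F G k * G 0.
Proof.
move=> Fh Gh FL GL G0 n0 kn [x0 [xi [xiF [eta etaG exi]]]].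
have Fc := locally_lipschitz_continuous FL; have Gc := locally_lipschitz_continuous GL.
have [p0|p0] := eqVneq p 0.
  have qP := rayleigh_regular_homogeneous Fh Gh Fc Gc G0.
  rewrite p0 in Fh Gh.
  have const y : F y / G y = F 0 / G 0 by rewrite !(homogeneous0_const y).
  have lamE : minmax_eigenvalue F G k = F 0 / G 0.
    have [A Ak] := admissible_nonempty (R := R) n0 kn.
    apply/eqP; rewrite eq_le; apply/andP; split.
      by apply: (minmax_le qP Ak) => y _; rewrite const.
    apply: minmax_ge => // B [_ _ [y By] _ _]; exists y => //; by rewrite const.
  rewrite lamE const; split=> //; rewrite divfK// -(homogeneous0_const x Gh Gc).
  exact: G0.
split; last by rewrite !(homogeneous_at0 p0) ?mulr0.
have := euler_subdiff Fh FL xiF; rewrite -exi dotvZl (euler_subdiff Gh GL etaG).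
rewrite mulrCA => /(mulfI p0) <-; rewrite mulfK//; exact: G0.
Qed.

Definition restriction_rows x k (U : 'I_k -> {set 'I_n}) : 'M[R]_(k, n) :=
  \matrix_(i < k) Defs.restrict x (U i).

Lemma mul_restriction_rows x k (U : 'I_k -> {set 'I_n}) t :
  t *m restriction_rows x U = scaled_sum x U t.
Proof. by rewrite mulmx_sum_row; apply: eq_bigr => i _; rewrite rowK. Qed.

(** The rows are nonzero and have disjoint supports. *)
Lemma restriction_rows_free x k (U : 'I_k -> {set 'I_n}) : disjoint_nonempty U ->
  (forall i, U i \subset Defs.supp x) -> row_free (restriction_rows x U).
Proof.
move=> [U0 Udisj] Ux; apply: inj_row_free => t; rewrite mul_restriction_rows => tU.
apply/rowP => i; have /set0Pn[j ji] := U0 i.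
have /rowP/(_ j) := tU; rewrite /scaled_sum summxE (bigD1 i) //= big1 => [|i' i'i].
  rewrite !mxE ji addr0 => /eqP; rewrite mulf_eq0 => /orP[/eqP//|].
  by have := fintype.subsetP (Ux i) _ ji; rewrite inE => /negbTE ->.
rewrite !mxE ifF ?mulr0//; apply/negbTE/negP => ji'.
by have := Udisj i' i i'i; move/setP/(_ j); rewrite !inE ji ji'.
Qed.

End HomogeneousPairs.

Lemma largest_le m (P : nat -> Prop) b :
  (forall k, (0 < k <= m)%N -> P k -> (k <= b)%N) -> (largest m P <= b)%N.
Proof.
move=> H; apply/bigmax_leqP => k /asboolP Pk.
have [->//|k0] := posnP k; apply: H => //.
by rewrite k0 -ltnS ltn_ord.
Qed.

(** * Independence numbers and nodal domains *)
Theorem theorem2p2 (R : realType) (n : nat) (p : R) (F G : 'rV[R]_n -> R)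
  (F_even : even_fun F) (G_even : even_fun G)
  (F_hom : homogeneous p F) (G_hom : homogeneous p G)
  (F_lip : locally_lipschitz F) (G_lip : locally_lipschitz G)
  (G_neq0 : forall x : 'rV[R]_n, x != 0 -> G x != 0) :
  (forall c : R,
     (level_independence F G c <=
        minn #|[pred i : 'I_n | (minmax_eigenvalue F G i.+1 <= c)%R]|
             #|[pred i : 'I_n | (minmax_eigenvalue F G i.+1 >= c)%R]|)%N) /\
  (forall (k : nat) (x : 'rV[R]_n) (r : nat),
     (1 <= k <= n)%N ->
     eigenpair F G (minmax_eigenvalue F G k) x ->
     multiplicity F G (minmax_eigenvalue F G k) = r ->
     (nodal_minus F G x <= k + r - 1)%N /\
     (nodal_plus F G x <= n - k + r)%N).
Proof.
have F_cont := locally_lipschitz_continuous F_lip.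
have G_cont := locally_lipschitz_continuous G_lip.
have qP := rayleigh_regular_homogeneous F_hom G_hom F_cont G_cont G_neq0.
have [s [s1 sG]] := nonvanishing_sign G_even G_hom G_cont G_neq0.
split=> [c|k x r /andP[k1 kn] xk mr].
  apply: largest_le => k /andP[k0 kn] [U Udisj Uc]; have n0 : (0 < n)%N by lia.
  have Tfree : row_free (restriction_rows (const_mx 1 : 'rV[R]_n) U).
    apply: restriction_rows_free => // i; apply/fintype.subsetP => j _.
    by rewrite inE mxE oner_neq0.
  have Tc t : t != 0 -> F (t *m restriction_rows (const_mx 1) U) /
      G (t *m restriction_rows (const_mx 1) U) = c.
    move=> t0; apply: Uc; last first.
      by rewrite -[0](mul0mx _ (restriction_rows (const_mx 1) U))
        (inj_eq (row_free_inj Tfree)).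
    rewrite mul_restriction_rows; apply: memv_suml => i _; apply: memvZ;
      apply: memv_span.
    apply/mapP; exists i; rewrite ?mem_enum//.
    by apply/rowP => j; rewrite !mxE.
  have up : minmax_eigenvalue F G k <= c.
    by apply: (minmax_le_subspace qP k0 Tfree) => t /Tc ->.
  have lo : c <= minmax_eigenvalue F G (n - k).+1.
    by apply: (minmax_ge_subspace qP _ Tfree) => [|t /Tc ->//]; rewrite k0.
  rewrite leq_min; apply/andP; split.
    rewrite -[X in (X <= _)%N](card_ord k).
    rewrite -(card_imset _ (f := widen_ord kn)) => [|i j /(congr1 val)/= ij];
      last exact: val_inj.
    apply: subset_leq_card; apply/fintype.subsetP => _ /imsetP[i _ ->]; rewrite inE /=.
    by apply: le_trans up; apply: minmax_mono => //; exact: ltn_ord.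
  rewrite -[X in (X <= _)%N](card_ord k).
  rewrite -(card_imset _ (f := fun i => rev_ord (widen_ord kn i))); last first.
    by move=> i j /rev_ord_inj /(congr1 val) /= ij; exact: val_inj.
  apply: subset_leq_card; apply/fintype.subsetP => _ /imsetP[i _ ->]; rewrite inE /=.
  apply: (le_trans lo); apply: minmax_mono => //; have := ltn_ord i; lia.
have n0 : (0 < n)%N by lia.
have [qx F0] := eigenpair_rayleigh F_hom G_hom F_lip G_lip G_neq0 n0 kn xk.
have eigr : odd_nonvanishing [set y | eigenpair F G (minmax_eigenvalue F G k) y] r.
  rewrite -mr; apply: genus_attained; first by exists x.
  by move=> [/eqP].
have contra_multiplicity j := minmax_multiplicity F_even G_even F_lip G_lip qP s1 sG F0
  (j := j) (r := r).
split; apply: largest_le => m /andP[m0 mn] [U [Udisj Ux Uq]].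
  have Tfree := restriction_rows_free Udisj Ux.
  have Tnz t : t != 0 ->
    F (t *m restriction_rows x U) / G (t *m restriction_rows x U) <=
      minmax_eigenvalue F G k.
    by move=> t0; rewrite mul_restriction_rows -qx; exact: Uq.
  have up := minmax_le_subspace qP m0 Tfree Tnz.
  rewrite leqNgt; apply/negP => mkr; have krm : (k + r <= m)%N by lia.
  have := contra_multiplicity k k1 _ eigr; rewrite ltxx => H; suff: false by [];
    apply: H; first lia.
  by apply: le_trans up; apply: minmax_mono.
have Tfree := restriction_rows_free Udisj Ux.
have Tnz t : t != 0 -> minmax_eigenvalue F G k <=
    F (t *m restriction_rows x U) / G (t *m restriction_rows x U).
  by move=> t0; rewrite mul_restriction_rows -qx; exact: Uq.
have lo : minmax_eigenvalue F G k <= minmax_eigenvalue F G (n - m).+1.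
  by apply: (minmax_ge_subspace qP _ Tfree Tnz); rewrite m0.
rewrite leqNgt; apply/negP => mkr.
have := contra_multiplicity (n - m).+1 isT _ eigr; rewrite ltNge lo => H;
  suff: false by []; apply: H; first lia.
by apply: minmax_mono => //; lia.
Qed.
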